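(* Let $\Omega\subset\mathbb{R}^N$ ($N\ge 2$) be a bounded smooth domain and let $1<p<\infty$. Let $\mathcal{A}$ be the set of all admissible pairs $(g,V)\in L^q(\Omega)\times L^q(\Omega)$. The first positive eigenvalue $\lambda(g,V)$ is continuous with respect to $(g,V)\in\mathcal{A}$, i.e., if $(g_n,V_n)\in\mathcal{A}$ for all $n\in\mathbb{N}$, $(g,V)\in\mathcal{A}$, and $(g_n,V_n)\to(g,V)$ strongly in $L^q(\Omega)\times L^q(\Omega)$, then $$\lambda(g_n,V_n)\to\lambda(g,V).$$
   Context: Exponents: $q$ is a finite exponent with $q>N/p$ if $1<p\le N$, and $q=1$ if $p>N$; $q'$ is the conjugate exponent of $q$ ($q'=\infty$ if $q=1$). Notation: $f^-=\min\{f,0\}$, $f^+=\max\{f,0\}$, and for $r=p$ or $r=pq'$, $$S_r=\inf\Big\{\int_\Omega|\nabla u|^p\,dx\colon u\in W^{1,p}_0(\Omega),\ \|u\|_{L^r(\Omega)}=1\Big\}.$$ A pair $(g,V)$ of measurable functions on $\Omega$ is called admissible if: (i) $g,V\in L^q(\Omega)$; (ii) either $\|V^-\|_{L^q(\Omega)}<S_{pq'}$, or $V\ge -S_p+\delta$ a.e. for some $\delta>0$ (which may depend on $V$); (iii) $g^+\not\equiv 0$. For an admissible pair, $\lambda(g,V)$ denotes the unique positive principal eigenvalue of $-\Delta_p u+V|u|^{p-2}u=\lambda g|u|^{p-2}u$ in $\Omega$, $u=0$ on $\partial\Omega$, where $\Delta_p u=\operatorname{div}(|\nabla u|^{p-2}\nabla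 u)$; it is characterized by $$\lambda(g,V)=\min\Big\{\int_\Omega |\nabla u|^p+V|u|^p\,dx\colon u\in W^{1,p}_0(\Omega),\ \int_\Omega g|u|^p\,dx=1\Big\}.$$ *)

(* Defs.v *)
From HB Require Import structures.
From mathcomp Require Import all_boot all_order all_algebra.
From mathcomp Require Import all_classical all_reals all_analysis.
Set Implicit Arguments. Unset Strict Implicit. Unset Printing Implicit Defensive.
Import Order.TTheory GRing.Theory Num.Theory.
Import numFieldNormedType.Exports.
Local Open Scope classical_set_scope.
Local Open Scope ring_scope.

(* The product sigma-algebra on row vectors, as for the tuples of the library. *)
Definition rV_display : measure_display -> measure_display.
Proof. exact. Qed.

Section rV_measurable.
Context {d} {T : sigmaRingType d} {n : nat}.
Definition rV_coord (i : 'I_n) (v : 'rV[T]_n) : T := v ord0 i.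
Let rV_set0 : g_sigma_preimage rV_coord set0.
Proof. exact: sigma_algebra0. Qed.
Let rV_setC A : g_sigma_preimage rV_coord A -> g_sigma_preimage rV_coord (~` A).
Proof. exact: sigma_algebraC. Qed.
Let rV_bigcup (F : _^nat) : (forall i, g_sigma_preimage rV_coord (F i)) ->
  g_sigma_preimage rV_coord (\bigcup_i (F i)).
Proof. exact: sigma_algebra_bigcup. Qed.
HB.instance Definition _ := @isMeasurable.Build (rV_display d)
  'rV[T]_n (g_sigma_preimage rV_coord) rV_set0 rV_setC rV_bigcup.
End rV_measurable.

Lemma measurable_rV_coord d (T : sigmaRingType d) n (i : 'I_n) :
  measurable_fun [set: 'rV[T]_n] (rV_coord i).
Proof.
move=> _ Y mY; rewrite setTI; apply: sub_sigma_algebra => /=.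
rewrite -bigcup_seq/=; exists i => /=; first by rewrite mem_index_enum.
by exists Y => //; rewrite setTI.
Qed.

Lemma measurable_fun_rVP d1 d2 (T1 : measurableType d1) (T2 : measurableType d2)
    n (f : T1 -> 'rV[T2]_n) :
  (forall i, measurable_fun [set: T1] (rV_coord i \o f)) ->
  measurable_fun [set: T1] f.
Proof.
move=> mf _ A mA.
suff : g_sigma_preimage (fun i => rV_coord i \o f) `<=` measurable.
  by rewrite g_sigma_preimage_comp; apply; exists A.
apply: smallest_sub; first exact: sigma_algebra_measurable.
case: n => [|n] in f mf A mA *; first by rewrite big_ord0.
rewrite -bigcup_mkord_ord; apply: bigcup_sub => i Ii.
by move=> B [C mC <-]; exact: mf.
Qed.

Section lebesgue_rV.
Context {R : realType}.

Definition rV_cons n (xv : measurableTypeR R * 'rV[R]_n) : 'rV[R]_n.+1 :=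
  row_mx (xv.1)%:M xv.2.

Definition rV_uncons n (w : 'rV[R]_n.+1) : measurableTypeR R * 'rV[R]_n :=
  (lsubmx (w : 'rV_(1 + n)) ord0 ord0, rsubmx (w : 'rV_(1 + n))).

Lemma rV_consK n : cancel (@rV_cons n) (@rV_uncons n).
Proof.
by move=> [x v]; rewrite /rV_uncons /rV_cons/= row_mxKl row_mxKr mxE eqxx mulr1n.
Qed.

Lemma rV_cons0 n xv : @rV_cons n xv ord0 ord0 = xv.1.
Proof.
case: xv => x v; rewrite -[RHS](mulr1n x).
apply: etrans (_ : row_mx (x%:M : 'M[R]_1) v ord0 (lshift n ord0) = _).
  by congr (_ _ _); exact/val_inj.
by rewrite row_mxEl mxE eqxx.
Qed.

Lemma rV_consS n xv j : @rV_cons n xv ord0 (lift ord0 j) = xv.2 ord0 j.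
Proof.
case: xv => x v.
apply: etrans (_ : row_mx (x%:M : 'M[R]_1) v ord0 (rshift 1 j) = _).
  by congr (_ _ _); exact/val_inj.
by rewrite row_mxEr.
Qed.

Lemma measurable_rV_cons n : measurable_fun setT (@rV_cons n).
Proof.
apply: measurable_fun_rVP => i.
case: (split_ordP (i : 'I_(1 + n))) => j ->.
  rewrite (_ : _ \o _ = fst) //; apply/funext => -[x v].
  rewrite /= /rV_coord /rV_cons; apply: etrans (row_mxEl _ _ _ _) _.
  by rewrite (ord1 j) mxE eqxx mulr1n.
rewrite (_ : _ \o _ = rV_coord j \o snd); last first.
  by apply/funext => -[x v]; apply: etrans (row_mxEr _ _ _ _) _.
by apply: measurableT_comp => //; exact: measurable_rV_coord.
Qed.

Lemma measurable_rV_uncons n : measurable_fun setT (@rV_uncons n).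
Proof.
apply/measurable_fun_pairP; split.
  rewrite (_ : _ \o _ = rV_coord ord0); first exact: measurable_rV_coord.
  apply/funext => w; rewrite /= /rV_coord mxE; congr (w _ _).
  exact/val_inj.
apply: measurable_fun_rVP => i.
rewrite (_ : _ \o _ = rV_coord (rshift 1 i)); first exact: measurable_rV_coord.
by apply/funext => w; rewrite /= /rV_coord mxE.
Qed.

Section step.
Context {n : nat} (m : {sigma_finite_measure set 'rV[R]_n -> \bar R}).

Definition lebesgue_rVS : set 'rV[R]_n.+1 -> \bar R :=
  pushforward (@lebesgue_measure R \x m)%E (@rV_cons n).

HB.instance Definition _ := Measure.copy lebesgue_rVS
  (measure_function_pushforward__canonical__measure_function_Measure
     (@lebesgue_measure R \x m)%E (@measurable_rV_cons n)).

Let sigma_finite_lebesgue_rVS : sigma_finite [set: 'rV[R]_n.+1] lebesgue_rVS.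
Proof.
have /sigma_finiteP[F [TF ndF Foo]] := sigma_finiteT (@lebesgue_measure R).
have /sigma_finiteP[G [TG ndG Goo]] := sigma_finiteT m.
exists (fun k => @rV_uncons n @^-1` (F k `*` G k)).
  rewrite -preimage_bigcup -[LHS](preimage_setT (@rV_uncons n)) -setXTT TF TG.
  congr (_ @^-1` _); apply/seteqP; split => -[x v] /=.
    move=> [[i _ Fix] [j _ Gjv]]; exists (maxn i j) => //=; split.
      by move: x Fix; exact/subsetPset/ndF/leq_maxl.
    by move: v Gjv; exact/subsetPset/ndG/leq_maxr.
  by move=> [i _ []] *; split; exists i.
move=> k; have [mF Fk] := Foo k; have [mG Gk] := Goo k; split.
  rewrite -[X in measurable X]setTI; apply: measurable_rV_uncons => //.
  exact: measurableX.
rewrite /lebesgue_rVS /pushforward -comp_preimage.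
rewrite (_ : _ \o _ = id) ?preimage_id; last first.
  by apply/funext => xv; exact: rV_consK.
by rewrite product_measure1E// lte_mul_pinfty// ge0_fin_numE.
Qed.

HB.instance Definition _ :=
  Measure_isSigmaFinite.Build _ _ _ lebesgue_rVS sigma_finite_lebesgue_rVS.
End step.

(* N-dimensional Lebesgue measure: iterated product of the one-dimensional one;
   see [lebesgue_rV_box]. *)
Fixpoint lebesgue_rV n : {sigma_finite_measure set 'rV[R]_n -> \bar R} :=
  if n is k.+1 then lebesgue_rVS (lebesgue_rV k) else dirac (0 : 'rV[R]_0).

Lemma measurable_rV_box n (A : 'I_n -> set R) :
  (forall i, measurable (A i)) ->
  measurable [set v : 'rV[R]_n | forall i, A i (v ord0 i)].
Proof.
move=> mA.
rewrite (_ : mkset _ = \bigcap_(i in [set: 'I_n]) (rV_coord i @^-1` A i)).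
  apply: fin_bigcap_measurable => // i _; rewrite -[X in measurable X]setTI.
  exact: measurable_rV_coord.
by apply/seteqP; split => v /= Av i; [move=> _; exact: Av|exact: Av].
Qed.

Lemma lebesgue_rV_box n (A : 'I_n -> set R) : (forall i, measurable (A i)) ->
  lebesgue_rV n [set v | forall i, A i (v ord0 i)] =
  (\prod_(i < n) lebesgue_measure (A i))%E.
Proof.
elim: n A => [|n IH] A mA.
  by rewrite big_ord0 /= diracE mem_set// => -[].
rewrite big_ord_recl -IH// -product_measure1E//.
- rewrite /= /lebesgue_rVS /pushforward.
  congr ((lebesgue_measure \x lebesgue_rV n)%E _).
  apply/seteqP; split => -[x v] /= Av.
    split => [|j]; first by have := Av ord0; rewrite rV_cons0.
    by have := Av (lift ord0 j); rewrite rV_consS.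
  by move=> i; case: (unliftP ord0 i) => [j|] ->;
    rewrite ?rV_cons0 ?rV_consS; case: Av.
- exact: mA.
- exact: (measurable_rV_box (A := fun i => A (lift ord0 i))).
Qed.
End lebesgue_rV.

Section euclidean.
Context {R : realType} {n : nat}.
Implicit Types (f : 'rV[R]_n -> R) (v w : 'rV[R]_n).

Definition dotv v w : R := \sum_(i < n) v ord0 i * w ord0 i.

(* The library's norm on row vectors is the maximum norm. *)
Definition enorm v : R := Num.sqrt (dotv v v).

Definition partial (i : 'I_n) f : 'rV[R]_n -> R :=
  fun x => 'D_(delta_mx ord0 i) f x.

Definition smooth f := forall s : seq 'I_n,
  continuous (foldr partial f s) /\
  forall i x, derivable (foldr partial f s) x (delta_mx ord0 i).

End euclidean.

(* Near each boundary point, the set lies strictly on one side of the graph of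
   a smooth function of all coordinates but one. *)
Definition smooth_boundary {R : realType} {N : nat} (Om : set 'rV[R]_N) :=
  forall x, (closure Om `\` interior Om) x ->
  exists (i : 'I_N) (above : bool) (gam : 'rV[R]_N.-1 -> R), smooth gam /\
    \forall y \near x, Om y <->
      if above then gam (col' i y) < y ord0 i else y ord0 i < gam (col' i y).

Definition bounded_smooth_domain {R : realType} {N : nat} (Om : set 'rV[R]_N) :=
  [/\ Om !=set0, open Om, connected Om, bounded_set Om & smooth_boundary Om].

Definition admissible_exponent {R : realType} (N : nat) (p q : R) :=
  (p <= N%:R -> N%:R / p < q) /\ (N%:R < p -> q = 1).

Section sobolev.
Context {R : realType} {N : nat}.
Variable Om : set 'rV[R]_N.
Implicit Types (u v g V phi : 'rV[R]_N -> R) (Du Dv : 'rV[R]_N -> 'rV[R]_N).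
Implicit Types (p q l : R) (r : \bar R).

Let mu := lebesgue_rV (R := R) N.

Definition normLp r u : \bar R := 'N[mu]_r[EFin \o (u \_ Om)]%E.

Definition in_Lp r u := u \_ Om \in Lfun mu r.

Definition test_function phi :=
  let supp := closure [set x | phi x != 0] in
  [/\ smooth phi, compact supp & supp `<=` Om].

Definition weak_gradient u Du := forall phi (i : 'I_N), test_function phi ->
  \int[mu]_(x in Om) (u x * partial i phi x) =
  - \int[mu]_(x in Om) (Du x ord0 i * phi x).

(* Sobolev functions are handled together with their weak gradient. *)
Definition W1p p u Du :=
  [/\ in_Lp p%:E u, forall i, in_Lp p%:E (fun x => Du x ord0 i) &
      weak_gradient u Du].

(* Closure of the test functions in [W1p]. *)
Definition W1p0 p u Du := W1p p u Du /\
  exists phi : nat -> 'rV[R]_N -> R,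
    [/\ forall k, test_function (phi k),
        normLp p%:E (phi k \- u) @[k --> \oo] --> 0%E &
        forall i, normLp p%:E (partial i (phi k) \- (fun x => Du x ord0 i))
                    @[k --> \oo] --> 0%E].

Definition sobolev_constant p r : \bar R :=
  ereal_inf [set s | exists u Du, [/\ W1p0 p u Du, normLp r u = 1%E &
    s = (\int[mu]_(x in Om) (enorm (Du x) `^ p)%:E)%E]].

Definition admissible p q g V :=
  let S := sobolev_constant p in
  let q' := hoelder_conjugate q%:E in
  [/\ in_Lp q%:E g, in_Lp q%:E V,
      (normLp q%:E (fun x => Num.min (V x) 0%R) < S (p%:E * q'))%E \/
      (exists2 delta : R, 0 < delta &
        \forall x \ae mu, Om x -> (- S p%:E + delta%:E <= (V x)%:E)%E) &
      ~ (\forall x \ae mu, Om x -> Num.max (g x) 0 = 0)].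

(* Weak formulation of
   - div(|Du|^(p-2) Du) + V |u|^(p-2) u = l g |u|^(p-2) u, u = 0 on the boundary. *)
Definition weak_solution p g V l u Du := W1p0 p u Du /\
  forall v Dv, W1p0 p v Dv ->
    \int[mu]_(x in Om) (enorm (Du x) `^ (p - 2) * dotv (Du x) (Dv x) +
                        V x * (`|u x| `^ (p - 2) * u x) * v x) =
    l * \int[mu]_(x in Om) (g x * (`|u x| `^ (p - 2) * u x) * v x).

Definition positive_principal_eigenvalue p g V l := 0 < l /\
  exists u Du, weak_solution p g V l u Du /\
    \forall x \ae mu, Om x -> 0 < u x.

Definition constrained_energies p g V : set R :=
  [set e | exists u Du, [/\ W1p0 p u Du,
    \int[mu]_(x in Om) (g x * `|u x| `^ p) = 1 &
    e = \int[mu]_(x in Om) (enorm (Du x) `^ p + V x * `|u x| `^ p)]].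

(* [l] is lambda(g, V): the positive principal eigenvalue, which is also the
   minimum of the constrained energies. *)
Definition is_lambda p g V l :=
  [/\ positive_principal_eigenvalue p g V l,
      constrained_energies p g V l & lbound (constrained_energies p g V) l].

End sobolev.

(* Main.v *)
Require Import Defs.
From mathcomp Require Import all_boot all_order all_algebra.
From mathcomp Require Import all_classical all_reals all_analysis.
From mathcomp Require Import measurable_realfun ess_sup_inf ring lra.
Import Order.TTheory GRing.Theory Num.Theory.
Import numFieldNormedType.Exports.
Set Implicit Arguments. Unset Strict Implicit. Unset Printing Implicit Defensive.
Local Open Scope classical_set_scope.
Local Open Scope ring_scope.

(** The key is the trace inequality
      [int_Om W |u|^p <= C ||W||_q int_Om |Du|^p]   for [u] in W^{1,p}_0(Om),
    valid because [N / q < p]: it makes the energies Lipschitz in [(g, V)] with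
    respect to the L^q norms, with constant [C int |Du|^p].  Inserting the
    minimizer for [(g, V)] into the problems for [(g_n, V_n)] gives
    [limsup lambda_n <= lambda].  Conversely, admissibility makes the energy for
    [V] coercive, so that the gradients of the minimizers for [(g_n, V_n)] are
    bounded, and inserting these into the problem for [(g, V)] gives
    [lambda <= liminf lambda_n]; no compactness is needed.

    The trace inequality is proved for test functions by comparing the averages
    of [|f|] over the cubes [x + [0, h)^N], [h = h_0 2^-k], which yields
    [|f x| <= C sum_k h_k^(1-N) int_(x + [0, h_k)^N) |grad f|].  After Jensen's
    and Tonelli's theorems the [k]-th term contributes
    [h_k^(p - N/q) ||W||_q int |grad f|^p], a convergent geometric series.
    Choosing [W] as a power of [|u|] (an indicator function if [q = 1]) turns the
    inequality into the embedding of W^{1,p}_0(Om) in L^{p q'}(Om). *)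

(** * Borel structure and translation invariance of Lebesgue measure *)

(** All perturbations are measured by the gradient energy alone: changing [g] or [V] by at most [K]
    in L^q changes the corresponding integral by at most [C * K * grad_energy], with one constant
    [C] for all functions. A bound on the energy is thus all that has to be known of a minimizer. A
    minimizer of one problem satisfies the constraint of another only approximately. The minimality
    is therefore extended by p-homogeneity to every [u] whose weighted integral is positive, and
    that integral is kept close to 1. Coercivity enters through the limit potential [V]: half of its
    constant absorbs the difference between [V_n] and [V], which bounds the energies of the
    minimizers uniformly in [n]. This uses an upper bound on [lambda_n], so the lower estimate
    relies on the upper one. The embedding in L^{p q'} serves the first alternative of
    admissibility: the quotient defining S_{p q'} controls [u] only once its L^{p q'} norm is known
    to be finite, whereas [u] is given as a limit of test functions in W^{1,p}. *)

Section borel_rV.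
Context {R : realType} {n : nat}.
Implicit Types (x y v : 'rV[R]_n) (U : set 'rV[R]_n).

Lemma ball_rVE x y (e : R) : 0 < e ->
  ball x e y <-> forall i, `|x ord0 i - y ord0 i| < e.
Proof.
move=> e0; split=> [[_ xy] i|xy]; first exact: xy.
by split => // i j; rewrite ord1; exact: xy.
Qed.

Lemma measurable_ball_rV x (e : R) : measurable (ball x e).
Proof.
have [e0|e0] := ltP 0 e; last first.
  by rewrite (_ : ball x e = set0)// -subset0 => y []; rewrite ltNge e0.
rewrite (_ : ball x e = [set v | forall i, ball (x ord0 i) e (v ord0 i)]); last first.
  by apply/seteqP; split => v; rewrite (ball_rVE _ _ e0).
apply: (@measurable_rV_box _ _ (fun i => ball (x ord0 i) e)) => i.
by apply: open_measurable; exact: ball_open.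
Qed.

(** Links the topology to the product sigma-algebra: balls of the maximum norm are boxes, and an
    open set is a countable union of balls with rational centre and radius [k.+1%:R^-1]. *)
Lemma open_measurable_rV U : open U -> measurable U.
Proof.
move=> oU.
pose c (k : 'rV[rat]_n * nat) : 'rV[R]_n := map_mx ratr k.1.
rewrite (_ : U = \bigcup_(k in [set k | ball (c k) k.2.+1%:R^-1 `<=` U])
    ball (c k) k.2.+1%:R^-1).
  rewrite bigcup_mkcond; apply: countable_bigcupT_measurable => // k.
  by case: ifPn => // _; exact: measurable_ball_rV.
apply/seteqP; split => [x Ux|x [k /= kU]]; last exact: kU.
have /nbhs_ballP[e /= e0 xeU] : nbhs x U by exact: open_nbhs_nbhs.
(* The radius is below [e / 2], so a ball of that radius which contains [x] stays inside
   [ball x e]. *)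
pose k := Num.truncn (2 / e).
have k0 : 0 < k.+1%:R^-1 :> R by rewrite invr_gt0.
have ke : k.+1%:R^-1 < e / 2.
  rewrite -[ltRHS]invrK ltf_pV2 ?posrE ?invr_gt0 ?divr_gt0//.
  by rewrite invf_div truncnS_gt.
have /choice[r rP] i : exists r : rat, `|ratr r - x ord0 i| < k.+1%:R^-1.
  have /rat_in_itvoo[r] : x ord0 i - k.+1%:R^-1 < x ord0 i + k.+1%:R^-1.
    by rewrite ltrBlDr -addrA ltrDl addr_gt0.
  by rewrite in_itv/= => xr; exists r; rewrite ltr_distl.
exists (\row_i r i, k) => /=; last first.
  by rewrite (ball_rVE _ _ k0) => i; rewrite !mxE; exact: rP.
move=> y; rewrite (ball_rVE _ _ k0) => ky.
apply: xeU; rewrite (ball_rVE _ _ e0) => i.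
have := ky i; have := rP i; rewrite !mxE => + ry.
rewrite distrC => xr; rewrite (le_lt_trans (ler_distD (ratr (r i)) _ _))//.
by rewrite [ltRHS]splitr ltrD// (lt_trans _ ke).
Qed.

Lemma continuous_measurable_rV (f : 'rV[R]_n -> R) :
  continuous f -> measurable_fun setT f.
Proof.
move=> /continuousP cf.
apply: (measurability _ (RGenOpens.measurableE R)) => _ [_ [a [b ->] <-]].
rewrite setTI; apply: open_measurable_rV; apply: cf; exact: interval_open.
Qed.

Lemma measurable_rV_shift v : measurable_fun setT (fun x => x + v).
Proof.
apply: measurable_fun_rVP => i.
rewrite (_ : _ \o _ = fun x => rV_coord i x + v ord0 i); last first.
  by apply/funext => x; rewrite /rV_coord/= mxE.
by apply: measurable_funD => //; exact: measurable_rV_coord.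
Qed.

End borel_rV.

Section translation.
Context {R : realType}.
Local Open Scope ereal_scope.

(** The translated measure agrees with Lebesgue measure on half-open intervals, and these determine
    it. *)
Lemma lebesgue_measure_shift (c : R) (A : set R) : measurable A ->
  lebesgue_measure ((fun x => (x + c)%R) @^-1` A) = lebesgue_measure A.
Proof.
have mc : measurable_fun setT (fun x : measurableTypeR R => (x + c)%R : measurableTypeR R).
  exact: measurable_funD.
move=> mA; apply/esym.
apply: (lebesgue_measure_unique (mu :=
  measure_function_pushforward__canonical__measure_function_Measure
    (@lebesgue_measure R) mc)) => //= _ [[a b]] _ <-.
rewrite /pushforward.
rewrite (_ : _ @^-1` _ = `]a - c, b - c]%classic)%R; last first.
  by apply/seteqP; split => x /=; rewrite !in_itv/= ltrBlDr lerBrDr.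
by rewrite !lebesgue_measure_itv/= !lte_fin ltrD2r -!EFinB opprB addrA subrK.
Qed.

(** Induction on the dimension along the iterated product: the induction hypothesis translates each
    slice, and the one-dimensional invariance translates the outer variable. *)
Lemma lebesgue_rV_shift n (v : 'rV[R]_n) (A : set 'rV[R]_n) : measurable A ->
  lebesgue_rV n ((fun x => (x + v)%R) @^-1` A) = lebesgue_rV n A.
Proof.
elim: n v A => [|n IH] v A mA.
  congr (_ _); apply/seteqP; split => x /=;
    by rewrite (_ : x + v = x)%R//; apply/rowP => -[].
pose c := v ord0 ord0; pose w := (\row_j v ord0 (lift ord0 j))%R : 'rV[R]_n.
have cons_shift x u : (rV_cons (x, u) + v = rV_cons (x + c, u + w))%R.
  apply/rowP => i; rewrite mxE.
  by case: (unliftP ord0 i) => [j|] ->; rewrite ?rV_cons0 ?rV_consS ?mxE.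
rewrite /= /lebesgue_rVS /pushforward.
set B := @rV_cons R n @^-1` A.
have mB : measurable B.
  by rewrite -[X in measurable X]setTI; exact: measurable_rV_cons.
transitivity ((@lebesgue_measure R \x lebesgue_rV n)
    [set xu | B (xu.1 + c, xu.2 + w)%R]).
  by congr (_ _); apply/seteqP; split => -[x u]; rewrite /B /= cons_shift.
rewrite /product_measure1.
transitivity (\int[lebesgue_measure]_x
    (fun x => lebesgue_rV n (xsection B x)) (x + c)%R).
  apply: eq_integral => x _ /=.
  rewrite -[RHS](IH w); last exact: measurable_xsection.
  by congr (_ _); apply/seteqP; split => u /=; rewrite /xsection/= !inE.
have mc : measurable_fun setT
    (fun x : measurableTypeR R => (x + c)%R : measurableTypeR R).
  exact: measurable_funD.
transitivity (\int[pushforward lebesgue_measure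
    (fun x : measurableTypeR R => (x + c)%R : measurableTypeR R)]_x
      lebesgue_rV n (xsection B x)).
  by rewrite ge0_integral_pushforward//; exact: measurable_fun_xsection.
by apply: eq_measure_integral => //= D mD _; exact: lebesgue_measure_shift.
Qed.

Lemma ge0_integral_rV_shift n (v : 'rV[R]_n) (D : set 'rV[R]_n)
    (f : 'rV[R]_n -> \bar R) :
  measurable D -> measurable_fun D f -> (forall x, D x -> 0 <= f x) ->
  \int[lebesgue_rV n]_(x in (fun x => (x + v)%R) @^-1` D) f (x + v)%R =
  \int[lebesgue_rV n]_(x in D) f x.
Proof.
move=> mD mf f0.
transitivity (\int[pushforward (lebesgue_rV n) (fun x => (x + v)%R)]_(x in D) f x).
  rewrite ge0_integral_pushforward//; first exact: measurable_rV_shift.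
  by move=> x /set_mem; exact: f0.
apply: eq_measure_integral => [|mshift A mA _]; first exact: measurable_rV_shift.
exact: lebesgue_rV_shift.
Qed.

End translation.

(** * Averages over cubes *)

Section boxes.
Context {R : realType} {n : nat}.
Implicit Types (x z : 'rV[R]_n) (l : 'I_n -> R).

(** Half-open, so that halving a side yields two disjoint boxes that are translates of each other;
    [x] is the lower corner. *)
Definition box x l : set 'rV[R]_n :=
  [set z | forall i, x ord0 i <= z ord0 i < x ord0 i + l i].

Lemma box_itvE x l : box x l =
  [set z | forall i, [set` `[x ord0 i, x ord0 i + l i[%R] (z ord0 i)].
Proof. by apply/seteqP; split=> z /= xz i; have := xz i; rewrite in_itv. Qed.

Lemma measurable_box x l : measurable (box x l).
Proof.
rewrite box_itvE.
by apply: (@measurable_rV_box _ _ (fun i => `[x ord0 i, x ord0 i + l i[%classic)).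
Qed.

Lemma lebesgue_rV_box_eq x l : (forall i, 0 < l i) ->
  lebesgue_rV n (box x l) = (\prod_(i < n) l i)%:E.
Proof.
move=> l0; rewrite box_itvE.
rewrite (@lebesgue_rV_box _ _ (fun i => `[x ord0 i, x ord0 i + l i[%classic))//.
rewrite -prodEFin; apply: eq_bigr => i _.
by rewrite lebesgue_measure_itv/= lte_fin ltrDl l0 -EFinB addrAC subrr add0r.
Qed.

End boxes.

(** * Variation along coordinate lines *)

Section shift_estimate.
Context {R : realType} {n : nat}.
Implicit Types (x z : 'rV[R]_n) (f : 'rV[R]_n -> R).
Let e (i : 'I_n) : 'rV[R]_n := delta_mx ord0 i.

Lemma continuous_line z i : continuous (fun t : R => z + t *: e i).
Proof.
move=> t; apply: cvgD; first exact: cvg_cst.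
by apply: cvgZr_tmp; exact: cvg_id.
Qed.

(** The difference quotients along the line and in direction [e i] are the same function of the
    increment; this opens the way to the one-variable fundamental theorem of calculus. *)
Lemma derivable_line f z i (t : R) : derivable f (z + t *: e i) (e i) ->
  derivable (fun u : R => f (z + u *: e i)) t 1 /\
  derive1 (fun u : R => f (z + u *: e i)) t = partial i f (z + t *: e i).
Proof.
have E : (fun h : R => h^-1 *: (((fun u : R => f (z + u *: e i)) \o shift t) (h *: 1)
      - f (z + t *: e i))) =
    (fun h : R => h^-1 *: ((f \o shift (z + t *: e i)) (h *: e i)
      - f (z + t *: e i))).
  apply/funext => h /=; congr (_ *: (f _ - _)).
  by rewrite [h%:A]mulr1 scalerDl addrCA addrA.
move=> df; split; first by rewrite /derivable E.
by rewrite derive1E /partial /derive E.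
Qed.

Lemma le_line_integral f z i (s : R) : 0 < s ->
  continuous f -> continuous (partial i f) -> (forall x, derivable f x (e i)) ->
  (`|f z|%:E <= `|f (z + s *: e i)|%:E +
    \int[lebesgue_measure]_(t in [set` `[0, s]%R]) `|partial i f (z + t *: e i)|%:E)%E.
Proof.
move=> s0 cf cdf df.
pose phi t := f (z + t *: e i).
have cphi : continuous phi.
  by move=> t; apply: continuous_comp; [exact: continuous_line|exact: cf].
have cdphi : continuous (fun t : R => partial i f (z + t *: e i)).
  by move=> t; apply: continuous_comp; [exact: continuous_line|exact: cdf].
have FTC : (\int[lebesgue_measure]_(t in [set` `[0, s]%R]) (partial i f (z + t *: e i))%:E
    = (phi s)%:E - (phi 0)%:E)%E.
  apply: (@continuous_FTC2 R (fun t => partial i f (z + t *: e i))) => //.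
  - exact: continuous_subspaceT.
  - split => [t _||]; first by have [] := derivable_line (df (z + t *: e i)).
    + exact/cvg_at_right_filter/cphi.
    + exact/cvg_at_left_filter/cphi.
  - by move=> t _; have [] := derivable_line (df (z + t *: e i)).
apply: (@le_trans _ _ (`|(phi s)%:E| + `|(phi s)%:E - (phi 0)%:E|)%E).
  rewrite -EFinB !abse_EFin -EFinD lee_fin.
  rewrite (_ : f z = phi s - (phi s - phi 0)) ?ler_normB//.
  by rewrite opprB addrCA subrr addr0 /phi scale0r addr0.
rewrite leeD2l// -FTC; apply: le_abse_integral => //.
apply/measurable_EFinP/measurable_funTS; exact: continuous_measurable_fun.
Qed.

End shift_estimate.

Section fubini_tonelli_on.
Local Open Scope ereal_scope.
Context d1 d2 (T1 : measurableType d1) (T2 : measurableType d2) (R : realType).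
Variables (m1 : {sigma_finite_measure set T1 -> \bar R})
  (m2 : {sigma_finite_measure set T2 -> \bar R}).
Variables (A : set T1) (B : set T2) (f : T1 * T2 -> \bar R).
Hypotheses (mA : measurable A) (mB : measurable B).
Hypotheses (mf : measurable_fun setT f) (f0 : forall z, 0 <= f z).

(** Extending [f] by zero outside the product of [A] and [B] reduces the exchange to integrals over
    the whole spaces. *)
Lemma fubini_tonelli_on :
  \int[m1]_(x in A) \int[m2]_(y in B) f (x, y) =
  \int[m2]_(y in B) \int[m1]_(x in A) f (x, y).
Proof.
pose g := f \_ (A `*` B).
have mg : measurable_fun setT g.
  apply/(measurable_restrictT _ _).1; first exact: measurableX.
  exact: measurable_funTS.
have g0 z : 0 <= g z by rewrite /g /patch; case: ifP.
have gAB x y : g (x, y) = if (x \in A) && (y \in B) then f (x, y) else 0.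
  by rewrite /g /patch in_setX.
rewrite integral_mkcond [RHS]integral_mkcond.
transitivity (\int[m1]_x \int[m2]_y g (x, y)).
  apply: eq_integral => x _; rewrite patchE; case: ifPn => xA.
    rewrite integral_mkcond; apply: eq_integral => y _.
    by rewrite gAB xA patchE.
  by rewrite integral0_eq// => y _; rewrite gAB (negbTE xA).
rewrite fubini_tonelli//; apply: eq_integral => y _.
rewrite patchE; case: ifPn => yB.
  rewrite [RHS]integral_mkcond; apply: eq_integral => x _.
  by rewrite gAB yB patchE andbT.
by rewrite integral0_eq// => x _; rewrite gAB (negbTE yB) andbF.
Qed.

Lemma measurable_integral_snd :
  measurable_fun setT (fun x => \int[m2]_(y in B) f (x, y)).
Proof.
rewrite [X in measurable_fun _ X](_ : _ = fubini_F m2 (f \_ (setT `*` B))).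
  apply: measurable_fun_fubini_tonelli_F => //; last first.
    by move=> z; rewrite /patch; case: ifP.
  apply/(measurable_restrictT _ _).1; first exact: measurableX.
  exact: measurable_funTS.
apply/funext => x; rewrite /fubini_F [LHS]integral_mkcond; apply: eq_integral => y _.
by rewrite /patch in_setX [x \in _]mem_set.
Qed.

Lemma measurable_integral_fst :
  measurable_fun setT (fun y => \int[m1]_(x in A) f (x, y)).
Proof.
rewrite [X in measurable_fun _ X](_ : _ = fubini_G m1 (f \_ (A `*` setT))).
  apply: measurable_fun_fubini_tonelli_G => //; last first.
    by move=> z; rewrite /patch; case: ifP.
  apply/(measurable_restrictT _ _).1; first exact: measurableX.
  exact: measurable_funTS.
apply/funext => y; rewrite /fubini_G [LHS]integral_mkcond; apply: eq_integral => x _.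
by rewrite /patch in_setX [y \in _]mem_set// andbT.
Qed.

End fubini_tonelli_on.

Section shift_boxes.
Context {R : realType} {n : nat}.
Implicit Types (x z : 'rV[R]_n) (l : 'I_n -> R).
Let e (i : 'I_n) : 'rV[R]_n := delta_mx ord0 i.
Let mu := lebesgue_rV (R := R) n.
Local Open Scope ereal_scope.

Lemma measurable_line i :
  measurable_fun setT (fun zt : 'rV[R]_n * measurableTypeR R =>
    (zt.1 + (zt.2 : R) *: e i)%R).
Proof.
apply: measurable_fun_rVP => j.
rewrite (_ : _ \o _ = fun zt : 'rV[R]_n * measurableTypeR R =>
    (rV_coord j zt.1 + (zt.2 : R) * e i ord0 j)%R); last first.
  by apply/funext => zt; rewrite /rV_coord /= !mxE.
apply: measurable_funD; last exact: measurable_funM.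
by apply: measurableT_comp => //; exact: measurable_rV_coord.
Qed.

Lemma box_shift x v l : (fun z => (z + v)%R) @^-1` box (x + v)%R l = box x l.
Proof.
apply/seteqP; split => z /= xz i; have := xz i; rewrite !mxE lerD2r;
  by rewrite addrAC ltrD2r.
Qed.

Variables (f : 'rV[R]_n -> R) (i : 'I_n).
Hypotheses (cf : continuous f) (cdf : continuous (partial i f)).
Hypothesis df : forall x, derivable f x (e i).

(** Integrates the line estimate over the box. After exchanging the integrals, the inner one for
    each [t] runs over the box translated by [t *: e i], which lies in [Q]; integrating over [t] in
    [[0, s]] gives the factor [s]. *)
Lemma le_integral_box_shift x l (s : R) (Q : set 'rV[R]_n) : (0 < s)%R ->
  measurable Q ->
  (forall z (t : R), box x l z -> (0 <= t <= s)%R -> Q (z + t *: e i)%R) ->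
  \int[mu]_(z in box x l) `|f z|%:E <=
  \int[mu]_(z in box (x + s *: e i)%R l) `|f z|%:E +
  s%:E * \int[mu]_(z in Q) `|partial i f z|%:E.
Proof.
move=> s0 mQ xQ; set B := box x l.
have mB : measurable B by exact: measurable_box.
have mf : measurable_fun setT (fun z => `|f z|%:E).
  by apply/measurable_EFinP/measurableT_comp => //; exact: continuous_measurable_rV.
have mdf : measurable_fun setT (fun z => `|partial i f z|%:E).
  by apply/measurable_EFinP/measurableT_comp => //; exact: continuous_measurable_rV.
have mdfl : measurable_fun setT (fun zt : 'rV[R]_n * measurableTypeR R =>
    `|partial i f (zt.1 + (zt.2 : R) *: e i)%R|%:E).
  exact: (measurableT_comp mdf (measurable_line i)).
pose G (z : 'rV[R]_n) :=
  \int[lebesgue_measure]_(t in [set` `[0, s]%R]) `|partial i f (z + t *: e i)|%:E.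
have mG : measurable_fun setT G.
  exact: (@measurable_integral_snd _ _ _ _ _ lebesgue_measure _
    (fun zt : 'rV[R]_n * measurableTypeR R =>
      `|partial i f (zt.1 + (zt.2 : R) *: e i)|%:E)).
have G0 z : 0 <= G z by apply: integral_ge0.
apply: (@le_trans _ _
    (\int[mu]_(z in B) (`|f (z + s *: e i)|%:E + G z))).
  apply: ge0_le_integral => //.
  - exact: measurable_funTS.
  - apply: emeasurable_funD; last exact: measurable_funTS.
    apply: measurable_funTS; apply: (measurableT_comp mf).
    exact: measurable_rV_shift.
  - by move=> z _; exact: le_line_integral.
rewrite ge0_integralD//; last 2 first.
  - apply: measurable_funTS; apply: (measurableT_comp mf).
    exact: measurable_rV_shift.
  - exact: measurable_funTS.
apply: leeD.
  have := @ge0_integral_rV_shift _ n (s *: e i) (box (x + s *: e i) l)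
    (fun z => `|f z|%:E).
  rewrite box_shift => -> //; first exact: measurable_box.
  exact: measurable_funTS.
rewrite (@fubini_tonelli_on _ _ _ _ _ mu lebesgue_measure _ _
  (fun zt : 'rV[R]_n * measurableTypeR R =>
      `|partial i f (zt.1 + (zt.2 : R) *: e i)|%:E))//=.
apply: (@le_trans _ _ (\int[lebesgue_measure]_(t in [set` `[0, s]%R])
    (cst (\int[mu]_(z in Q) `|partial i f z|%:E) t))); last first.
  by rewrite integral_cst//= lebesgue_measure_itv/= lte_fin s0 sube0 muleC.
apply: ge0_le_integral.
- exact: measurable_itv.
- by move=> t _; apply: integral_ge0.
- apply: measurable_funTS; exact: (@measurable_integral_fst _ _ _ _ _ mu _
    (fun zt : 'rV[R]_n * measurableTypeR R =>
      `|partial i f (zt.1 + (zt.2 : R) *: e i)|%:E)).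
- exact: measurable_cst.
- move=> t /=; rewrite in_itv/= => ts.
  rewrite -[leRHS](ge0_integral_rV_shift (t *: e i))//; last first.
    exact: measurable_funTS.
  apply: ge0_subset_integral => //.
  - rewrite -[X in measurable X]setTI; exact: measurable_rV_shift.
  - apply: measurable_funTS; apply: (measurableT_comp mdf).
    exact: measurable_rV_shift.
  - by move=> z Bz /=; exact: xQ.
Qed.

End shift_boxes.

(** * Bisection of cubes *)

Section cubes.
Context {R : realType} {n : nat}.
Implicit Types (x z : 'rV[R]_n) (l : 'I_n -> R) (h s : R).
Let mu := lebesgue_rV (R := R) n.
Local Open Scope ereal_scope.

Definition cube x h := box x (fun=> h).

Lemma box_split x l (j : 'I_n) s : (0 < s)%R -> l j = (2 * s)%R ->
  let l' i := if i == j then s else l i in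
  box x l = box x l' `|` box (x + s *: delta_mx ord0 j) l' /\
  [disjoint box x l' & box (x + s *: delta_mx ord0 j) l'].
Proof.
move=> s0 lj l'; split; last first.
  rewrite disj_set2E; apply/eqP; rewrite -subset0 => z [/= /(_ j) + /(_ j)].
  rewrite /l' !mxE !eqxx/= mulr1 => /andP[_ zs] /andP[sz _].
  by move: (lt_le_trans zs sz); rewrite ltxx.
apply/seteqP; split => [z zx|z [zx|zx] i].
- have [zs|zs] := ltP (z ord0 j) (x ord0 j + s)%R; [left|right] => i;
    rewrite /l' ?mxE; have := zx i; have [->|ij] := eqVneq i j => //=.
  + by rewrite zs => /andP[->].
  + by rewrite mulr1 zs lj mulr_natl mulr2n addrA/= => /andP[].
  + by rewrite mulr0 addr0.
- have := zx i; rewrite /l'; have [->|//] := eqVneq i j.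
  move=> /andP[-> /lt_le_trans]; apply.
  by rewrite lj lerD2l mulr_natl mulr2n lerDl ltW.
- have := zx i; rewrite /l' !mxE; have [->|] := eqVneq i j => /=.
    rewrite mulr1 lj mulr_natl mulr2n addrA => /andP[+ ->]; rewrite andbT.
    by apply: le_trans; rewrite lerDl ltW.
  by rewrite mulr0 addr0.
Qed.

Variable f : 'rV[R]_n -> R.
Hypotheses (cf : continuous f) (cdf : forall i, continuous (partial i f)).
Hypothesis df : forall i x, derivable f x (delta_mx ord0 i).

(** The l^1 norm of the gradient dominates every partial derivative, so that all directions of
    bisection share one error term. *)
Definition grad1 z : R := \sum_(i < n) `|partial i f z|.

Lemma grad1_ge0 z : (0 <= grad1 z)%R.
Proof. exact: sumr_ge0. Qed.

Lemma measurable_grad1 : measurable_fun setT grad1.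
Proof.
apply: measurable_sum => i; apply: measurableT_comp => //.
exact: continuous_measurable_rV.
Qed.

Let mf : measurable_fun setT (fun z => `|f z|%:E).
Proof.
by apply/measurable_EFinP/measurableT_comp => //; exact: continuous_measurable_rV.
Qed.

Let mg : measurable_fun setT (fun z => (grad1 z)%:E).
Proof. by apply/measurable_EFinP; exact: measurable_grad1. Qed.

Lemma le_integral_partial_grad1 i (Q : set 'rV[R]_n) : measurable Q ->
  \int[mu]_(z in Q) `|partial i f z|%:E <= \int[mu]_(z in Q) (grad1 z)%:E.
Proof.
move=> mQ; apply: ge0_le_integral => //.
- apply: measurable_funTS; apply/measurable_EFinP/measurableT_comp => //.
  exact: continuous_measurable_rV.
- exact: measurable_funTS.
- move=> z _; rewrite lee_fin /grad1 (bigD1 i)//= lerDl.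
  exact: sumr_ge0.
Qed.

(** The upper half of the box is the lower half shifted by [s]. One copy of the integral over the
    lower half is kept, the other is replaced by the integral over the upper half at the cost of the
    gradient term. *)
Lemma bisect_side x l (j : 'I_n) s (Q : set 'rV[R]_n) : (0 < s)%R ->
  l j = (2 * s)%R -> measurable Q -> box x l `<=` Q ->
  2%:E * \int[mu]_(z in box x (fun i => if i == j then s else l i)) `|f z|%:E <=
  \int[mu]_(z in box x l) `|f z|%:E + s%:E * \int[mu]_(z in Q) (grad1 z)%:E.
Proof.
move=> s0 lj mQ lQ.
have [E dE] := box_split x s0 lj.
rewrite [in leRHS]E ge0_integral_setU//; last 3 first.
  - exact: measurable_box.
  - exact: measurable_box.
  - exact: measurable_funTS.
set l' := (fun i => if i == j then s else l i) in E dE *.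
rewrite (_ : 2%:E = 1 + 1)// ge0_muleDl// mul1e -addeA leeD2l//.
have sQ z (t : R) : box x l' z -> (0 <= t <= s)%R -> Q (z + t *: delta_mx ord0 j)%R.
  move=> zl /andP[t0 ts]; apply: lQ; rewrite E.
  have [zt|zt] := ltP (z ord0 j + t)%R (x ord0 j + s)%R; [left|right] => i;
    have := zl i; rewrite /l' !mxE/=; have [->|ij] := eqVneq i j => /=;
    rewrite ?mulr1 ?mulr0 ?addr0//.
    by move=> /andP[xz _]; rewrite zt (le_trans xz)//= lerDl.
  by move=> /andP[_ zx]; rewrite zt/= ltr_leD.
apply: le_trans (le_integral_box_shift cf (@cdf j) (@df j) s0 mQ sQ) _.
by rewrite leeD2l// lee_wpmul2l ?lee_fin ?(ltW s0)// le_integral_partial_grad1.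
Qed.

Lemma bisect_cube x h : (0 < h)%R ->
  (2 ^+ n)%:E * \int[mu]_(z in cube x (h / 2)) `|f z|%:E <=
  \int[mu]_(z in cube x h) `|f z|%:E +
    (2 ^+ n * h)%:E * \int[mu]_(z in cube x h) (grad1 z)%:E.
Proof.
move=> h0; set J := \int[mu]_(z in cube x h) (grad1 z)%:E.
have J0 : 0 <= J by apply: integral_ge0 => z _; rewrite lee_fin grad1_ge0.
(* The sides are halved one at a time; [l j] has its first [j] sides halved. The error after [j]
   halvings is at most [2 ^+ j * h] times [J], because each new halving adds only
   [2 ^+ j * (h / 2)]. *)
pose l (j : nat) (i : 'I_n) := if (i < j)%N then (h / 2)%R else h.
suff H j : (j <= n)%N -> (2 ^+ j)%:E * \int[mu]_(z in box x (l j)) `|f z|%:E <=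
    \int[mu]_(z in cube x h) `|f z|%:E + (2 ^+ j * h)%:E * J.
  rewrite (_ : cube x (h / 2) = box x (l n)); first exact: H.
  by congr box; apply/funext => i; rewrite /l ltn_ord.
elim: j => [_|j IH jn].
  rewrite expr0 mul1e (_ : box x (l 0%N) = cube x h)//.
  by rewrite leeDl// mule_ge0// lee_fin mul1r ltW.
have IHj := IH (ltnW jn).
have h20 : (0 < h / 2)%R by rewrite divr_gt0.
have lj : l j (Ordinal jn) = (2 * (h / 2))%R by rewrite /l ltnn mulrC divfK.
have lQ : box x (l j) `<=` cube x h.
  move=> z zx i; have := zx i; rewrite /l; case: ifPn => // _.
  move=> /andP[-> /lt_le_trans]; apply.
  by rewrite lerD2l ler_pdivrMr// ler_peMr ?ler1n// ltW.
have B := bisect_side h20 lj (measurable_box _ _) lQ.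
rewrite (_ : (fun i => if i == _ then _ else _) = l j.+1) in B; last first.
  apply/funext => i; rewrite /l.
  have [->|] := eqVneq i (Ordinal jn); first by rewrite ltnSn.
  by rewrite -(inj_eq val_inj)/= ltnS [in RHS]leq_eqVlt => /negbTE ->.
rewrite [in leLHS]exprSr EFinM -[leLHS]muleA.
apply: (@le_trans _ _ ((2 ^+ j)%:E * (\int[mu]_(z in box x (l j)) `|f z|%:E
    + (h / 2)%:E * J))).
  by rewrite lee_wpmul2l// lee_fin exprn_ge0.
rewrite ge0_muleDr; last 2 first.
  - by apply: integral_ge0.
  - by rewrite mule_ge0// lee_fin divr_ge0// ltW.
apply: (le_trans (leeD2r _ IHj)); rewrite -addeA leeD2l//.
rewrite muleA -ge0_muleDl ?lee_fin ?mulr_ge0 ?exprn_ge0 ?invr_ge0 ?(ltW h0)//.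
rewrite lee_wpmul2r// -EFinM -EFinD lee_fin.
rewrite exprSr -mulrDr -[leRHS]mulrA ler_pM2l ?exprn_gt0//.
by move: h0; lra.
Qed.

End cubes.

(** * Telescoping over dyadic scales *)

Section telescoping.
Context {R : realType} {n : nat}.
Implicit Types (x z : 'rV[R]_n) (l : 'I_n -> R) (h s : R).
Let mu := lebesgue_rV (R := R) n.
Local Open Scope ereal_scope.

Lemma lebesgue_rV_cube x h : (0 < h)%R -> mu (cube x h) = (h ^+ n)%:E.
Proof.
by move=> h0; rewrite lebesgue_rV_box_eq//= prodr_const card_ord.
Qed.

Variable f : 'rV[R]_n -> R.
Hypotheses (cf : continuous f) (cdf : forall i, continuous (partial i f)).
Hypothesis df : forall i x, derivable f x (delta_mx ord0 i).

Let mf : measurable_fun setT (fun z => `|f z|%:E).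
Proof.
by apply/measurable_EFinP/measurableT_comp => //; exact: continuous_measurable_rV.
Qed.

Definition cube_avg x h := (h ^- n)%:E * \int[mu]_(z in cube x h) `|f z|%:E.
Definition cube_grad x h :=
  (h * h ^- n)%:E * \int[mu]_(z in cube x h) (grad1 f z)%:E.

Lemma cube_grad_ge0 x h : (0 <= h)%R -> 0 <= cube_grad x h.
Proof.
move=> h0; rewrite mule_ge0// ?lee_fin ?mulr_ge0 ?invr_ge0 ?exprn_ge0//.
by apply: integral_ge0 => z _; rewrite lee_fin grad1_ge0.
Qed.

(** This is [bisect_cube] divided by the volume [h ^+ n]; the factor [2 ^+ n] on its left is the
    ratio of the two volumes. *)
Lemma cube_avg_half x h : (0 < h)%R ->
  cube_avg x (h / 2) <= cube_avg x h + (2 ^+ n)%:E * cube_grad x h.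
Proof.
move=> h0; have hn0 : 0 <= (h ^- n)%:E by rewrite lee_fin invr_ge0 exprn_ge0 ?ltW.
have I0 : 0 <= \int[mu]_(z in cube x h) `|f z|%:E.
  by apply: integral_ge0 => z _; rewrite lee_fin.
have J0 : 0 <= (2 ^+ n * h)%:E * \int[mu]_(z in cube x h) (grad1 f z)%:E.
  rewrite mule_ge0 ?lee_fin ?mulr_ge0 ?exprn_ge0 ?(ltW h0)//.
  by apply: integral_ge0 => z _; rewrite lee_fin grad1_ge0.
have := lee_wpmul2l hn0 (bisect_cube cf cdf df x h0).
rewrite muleA -EFinM mulrC (ge0_muleDr _ I0 J0).
rewrite /cube_avg expr_div_n invf_div => /le_trans; apply.
by rewrite leeD2l// /cube_grad !muleA -!EFinM mulrCA [(h ^- n * h)%R]mulrC.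
Qed.

Lemma cube_avg_iter x h K : (0 < h)%R ->
  cube_avg x (h / 2 ^+ K) <=
  cube_avg x h + (2 ^+ n)%:E * \sum_(k < K) cube_grad x (h / 2 ^+ k).
Proof.
move=> h0; elim: K => [|K IH].
  by rewrite expr0 divr1 big_ord0 mule0 adde0.
have hK0 : (0 < h / 2 ^+ K)%R by rewrite divr_gt0 ?exprn_gt0.
rewrite exprSr invfM mulrA (le_trans (cube_avg_half x hK0))//.
apply: (le_trans (leeD2r _ IH)).
rewrite big_ord_recr/= [in leRHS]ge0_muleDr ?addeA//; last first.
  by apply: cube_grad_ge0; exact: ltW.
by apply: sume_ge0 => k _; apply: cube_grad_ge0; rewrite divr_ge0// ?exprn_ge0// ltW.
Qed.

(** One half of the convergence of the averages to the value at [x], which is the half that an upper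
    bound for [f] at [x] calls for. It follows from continuity, since small cubes with corner [x]
    lie in a small ball around [x]. *)
Lemma cube_avg_cvg x h : (0 < h)%R -> forall eps : R, (0 < eps)%R ->
  \forall k \near \oo, (`|f x| - eps)%:E <= cube_avg x (h / 2 ^+ k).
Proof.
move=> h0 eps eps0.
have [fe|fe] := leP `|f x|%R eps.
  near=> k; apply: (@le_trans _ _ 0); first by rewrite lee_fin subr_le0.
  rewrite mule_ge0// ?lee_fin ?invr_ge0 ?exprn_ge0 ?divr_ge0 ?exprn_ge0 ?(ltW h0)//.
  by apply: integral_ge0 => z _; rewrite lee_fin.
have : \forall z \near x, (`|f x| - eps < `|f z|)%R.
  have /cvgr_dist_lt/(_ eps eps0) := @cf x.
  apply: filterS => z fxz; rewrite ltrBlDr -ltrBlDl.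
  by apply: le_lt_trans fxz; exact: lerB_dist.
move=> /nbhs_ballP[d /= d0 xd].
have : (h / 2 ^+ k)%R @[k --> \oo] --> (0%R : R).
  rewrite -[X in _ --> X](mulr0 h); apply: cvgM; first exact: cvg_cst.
  under eq_fun do rewrite -exprVn.
  by apply: cvg_expr; rewrite ger0_norm ?invr_ge0// invf_lt1 ?ltr1n.
move=> /cvgr_lt/(_ d d0); apply: filterS => k hkd.
have hk0 : (0 < h / 2 ^+ k)%R by rewrite divr_gt0 ?exprn_gt0.
set h' := (h / 2 ^+ k)%R in hkd hk0 *.
apply: (@le_trans _ _ ((h' ^- n)%:E * \int[mu]_(z in cube x h') (`|f x| - eps)%:E)).
  have -> : \int[mu]_(z in cube x h') (`|f x| - eps)%:E =
      (`|f x| - eps)%:E * (h' ^+ n)%:E.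
    rewrite integral_cst; last exact: measurable_box.
    by congr (_ * _); exact: lebesgue_rV_cube.
  by rewrite -!EFinM lee_fin mulrC mulfK// expf_neq0// gt_eqF.
rewrite lee_wpmul2l ?lee_fin ?invr_ge0 ?exprn_ge0 ?(ltW hk0)//.
apply: ge0_le_integral.
- exact: measurable_box.
- by move=> z _; rewrite lee_fin subr_ge0 ltW.
- exact: measurable_cst.
- exact: measurable_funTS.
- move=> z zx; rewrite lee_fin ltW//; apply: xd.
  rewrite (ball_rVE _ _ d0) => i; have /andP[xz zh] := zx i.
  by rewrite distrC ger0_norm ?subr_ge0// ltrBlDl (lt_trans zh)// ltrD2l.
Unshelve. all: by end_near. Qed.

Variable M : R.
Hypothesis M0 : (0 < M)%R.
Hypothesis f_out : forall z, f z != 0%R -> forall i, (`|z ord0 i| < M)%R.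

(** The telescoping has to start at an average that the gradient controls. Shifting the cube of side
    [2 * M] by [2 * M] in direction [i] moves it out of the region where [f] can be nonzero, and all
    intermediate positions stay in the cube of side [4 * M]. *)
Lemma cube_avg_top x (i : 'I_n) : (`|x ord0 i| < M)%R ->
  cube_avg x (2 * M) <= (2 ^+ n)%:E * cube_grad x (4 * M).
Proof.
move=> xM; have M20 : (0 < 2 * M)%R by rewrite mulr_gt0.
have sQ z (t : R) : box x (fun=> 2 * M)%R z -> (0 <= t <= 2 * M)%R ->
    cube x (4 * M) (z + t *: delta_mx ord0 i)%R.
  move=> zx /andP[t0 tM] j; have := zx j; rewrite !mxE /=.
  by case: eqP => _ /=; rewrite ?mulr1 ?mulr0; move: M20; lra.
have := le_integral_box_shift cf (@cdf i) (@df i) M20 (measurable_box _ _) sQ.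
rewrite [X in _ <= X + _]integral0_eq ?add0e; last first.
  move=> z zx; have [->|/f_out/(_ i)] := eqVneq (f z) 0%R; first by rewrite normr0.
  have := zx i; rewrite !mxE !eqxx /= mulr1 => /andP[xz _] zM.
  exfalso; move: xM zM xz; rewrite !ltr_norml => /andP[? ?] /andP[? ?]; lra.
move=> le1.
have hn0 : 0 <= ((2 * M) ^- n)%:E by rewrite lee_fin invr_ge0 exprn_ge0 ?ltW.
rewrite /cube_avg (le_trans (lee_wpmul2l hn0 le1))//.
rewrite /cube_grad muleA -EFinM muleA -EFinM.
rewrite (_ : 2 ^+ n * _ = 4 * M * (2 * M) ^- n)%R; last first.
  rewrite (_ : 4 * M = 2 * (2 * M))%R; last by ring.
  rewrite [((2 * (2 * M)) ^+ n)%R]exprMn invfM mulrCA; congr (_ * _)%R.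
  by rewrite mulrA divff ?mul1r// expf_neq0.
apply: (@le_trans _ _ (((2 * M) ^- n * (2 * M))%:E *
    \int[mu]_(z in cube x (4 * M)) (grad1 f z)%:E)).
  rewrite lee_wpmul2l//; first by rewrite lee_fin mulr_ge0 ?invr_ge0 ?exprn_ge0 ?(ltW M20).
  apply: le_integral_partial_grad1 => //; exact: measurable_box.
rewrite lee_wpmul2r//.
  by apply: integral_ge0 => z _; rewrite lee_fin grad1_ge0.
rewrite lee_fin mulrC ler_wpM2r ?invr_ge0 ?exprn_ge0 ?(ltW M20)//.
by move: M0; lra.
Qed.

Lemma le_cube_grad_series x (i : 'I_n) : (`|x ord0 i| < M)%R ->
  `|f x|%:E <= (2 ^+ n)%:E * \sum_(k <oo) cube_grad x (4 * M / 2 ^+ k).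
Proof.
move=> xM; have M40 : (0 < 4 * M)%R by rewrite mulr_gt0.
have P0 k : 0 <= cube_grad x (4 * M / 2 ^+ k).
  by apply: cube_grad_ge0; rewrite divr_ge0 ?exprn_ge0 ?(ltW M40).
apply/lee_subgt0Pr => eps eps0; rewrite -EFinB.
have [k _ /(_ k.+1 (leqnSn k)) H] := cube_avg_cvg x M40 eps0.
apply: (le_trans H).
rewrite exprS invfM mulrA (_ : 4 * M / 2 = 2 * M)%R; last by field.
apply: (le_trans (cube_avg_iter x k _)); first by rewrite mulr_gt0.
apply: (@le_trans _ _ ((2 ^+ n)%:E * \sum_(j < k.+1) cube_grad x (4 * M / 2 ^+ j))).
  (* The first term of the series, at scale [4 * M], pays for the top average; the remaining ones
     are the scales [2 * M / 2 ^+ j] of the telescoping, with the index shifted by one. *)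
  rewrite big_ord_recl/= expr0 divr1 [in leRHS]ge0_muleDr//; last 2 first.
  - by apply: cube_grad_ge0; exact: ltW.
  - by apply: sume_ge0.
  rewrite leeD ?(@cube_avg_top x i)// lee_wpmul2l ?lee_fin ?exprn_ge0//.
  rewrite le_eqVlt; apply/orP; left; apply/eqP; apply: eq_bigr => j _.
  by rewrite /bump/= add1n exprS invfM mulrA; congr cube_grad; field.
rewrite lee_wpmul2l ?lee_fin ?exprn_ge0//.
rewrite -(big_mkord xpredT (fun j => cube_grad x (4 * M / 2 ^+ j))).
exact: nneseries_lim_ge.
Qed.

End telescoping.

(** * The trace inequality for test functions *)

Section mean_estimates.
Context {R : realType}.

Lemma ler_powR2 (r x y : R) : 0 <= r -> 0 <= x -> x <= y -> x `^ r <= y `^ r.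
Proof.
by move=> r0 x0 xy; apply: ge0_ler_powR => //; rewrite nnegrE ?(le_trans x0 xy).
Qed.

Lemma powRK (r x : R) : r != 0 -> 0 <= x -> (x `^ r) `^ r^-1 = x.
Proof. by move=> r0 x0; rewrite -powRrM mulfV// powRr1. Qed.

Lemma powRVK (r x : R) : r != 0 -> 0 <= x -> (x `^ r^-1) `^ r = x.
Proof. by move=> r0 x0; rewrite -powRrM mulVf// powRr1. Qed.

Lemma powRV (r x : R) : 0 <= x -> x^-1 `^ r = (x `^ r)^-1.
Proof. by move=> x0; rewrite -powR_inv1// powRAC powR_inv1 ?powR_ge0. Qed.

Lemma powRX (r x : R) (k : nat) : 0 <= x -> (x ^+ k) `^ r = (x `^ r) ^+ k.
Proof.
by move=> x0; rewrite -(powR_mulrn k x0) powRAC powR_mulrn ?powR_ge0.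
Qed.

Local Open Scope ereal_scope.

(* Replaces Jensen's inequality, at the cost of a factor 2:
   [t <= s + s^(1-r) t^r] for [s > 0]. *)
Lemma integral_le_mean d (T : measurableType d) (mu : {measure set T -> \bar R})
    (A : set T) (G : T -> R) (a s r : R) :
  measurable A -> mu A = a%:E -> (0 < s)%R -> (1 <= r)%R ->
  measurable_fun A G -> (forall x, 0 <= G x)%R ->
  \int[mu]_(x in A) (G x `^ r)%:E <= (a * s `^ r)%:E ->
  \int[mu]_(x in A) (G x)%:E <= (2 * a * s)%:E.
Proof.
move=> mA Aa s0 r1 mG G0 Gr.
have mGr : measurable_fun A (fun x => (G x `^ r)%:E).
  by apply/measurable_EFinP; apply: (measurableT_comp (measurable_powR r)).
apply: (@le_trans _ _
    (\int[mu]_(x in A) (cst s%:E x + (s `^ (1 - r))%:E * (G x `^ r)%:E))).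
  apply: ge0_le_integral => //.
  - by move=> x _; rewrite lee_fin.
  - exact/measurable_EFinP.
  - by apply: emeasurable_funD => //; exact: measurable_funeM.
  - move=> x _; rewrite -EFinM -EFinD lee_fin.
    have [Gs|sG] := leP (G x) s.
      by rewrite (le_trans Gs)// lerDl mulr_ge0 ?powR_ge0.
    have Gx0 := lt_trans s0 sG.
    rewrite (@le_trans _ _ (s `^ (1 - r) * G x `^ r)%R) ?lerDr ?(ltW s0)//.
    rewrite -[leLHS](powRr1 (ltW Gx0)) -{1}(subrK r 1%R).
    rewrite powRD; last by rewrite (gt_eqF Gx0) implybT.
    rewrite ler_wpM2r ?powR_ge0// -opprB !powRN lef_pV2 ?posrE ?powR_gt0//.
    by rewrite ler_powR2 ?subr_ge0// ltW.
rewrite ge0_integralD//; last 3 first.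
- by move=> x _; rewrite lee_fin ltW.
- by move=> x _; rewrite mule_ge0// lee_fin powR_ge0.
- exact: measurable_funeM.
rewrite ge0_integralZl_EFin ?powR_ge0//; last by move=> x _; rewrite lee_fin powR_ge0.
rewrite integral_cst// Aa.
apply: (@le_trans _ _ ((s * a)%:E + (s `^ (1 - r))%:E * (a * s `^ r)%:E)).
  by rewrite -EFinM leeD2l// lee_wpmul2l ?lee_fin ?powR_ge0.
rewrite -EFinM -EFinD lee_fin mulrCA -powRD; last by rewrite (gt_eqF s0) implybT.
rewrite subrK powRr1 ?(ltW s0)//.
by rewrite -mulrA mulr_natl mulr2n mulrC.
Qed.

Lemma nneseries_geometric_le (a z : R) : (0 <= a)%R -> (0 < z < 1)%R ->
  \sum_(k <oo) (a * z ^+ k)%:E <= (a / (1 - z))%:E.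
Proof.
move=> a0 /andP[z0 z1]; apply: lime_le.
  by apply: is_cvg_nneseries => k _ _; rewrite lee_fin mulr_ge0// exprn_ge0// ltW.
apply: nearW => k; rewrite sumEFin lee_fin.
have z1' : (`|z| < 1)%R by rewrite gtr0_norm.
by have := geometric_le_lim k a0 z0 z1'; rewrite seriesEnat.
Qed.

End mean_estimates.

Section pointwise_bound.
Context {R : realType} {n : nat}.
Implicit Types (x z : 'rV[R]_n) (h : R).
Let mu := lebesgue_rV (R := R) n.
Local Open Scope ereal_scope.

Variable f : 'rV[R]_n -> R.
Hypotheses (cf : continuous f) (cdf : forall i, continuous (partial i f)).
Hypothesis df : forall i x, derivable f x (delta_mx ord0 i).
Variables (M : R) (p : R).
Hypotheses (M0 : (0 < M)%R) (p1 : (1 < p)%R).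
Hypothesis f_out : forall z, f z != 0%R -> forall i, (`|z ord0 i| < M)%R.

(** [h] to the power [p] times the mean of the p-th power of [grad1]. Since [cube_grad] is [h] times
    the mean of [grad1], the two compare with a constant that does not depend on [h]. *)
Definition cube_gradp x h :=
  (h `^ p * h ^- n)%:E * \int[mu]_(z in cube x h) (grad1 f z `^ p)%:E.

Lemma cube_gradp_ge0 x h : (0 <= h)%R -> 0 <= cube_gradp x h.
Proof.
move=> h0; rewrite mule_ge0 ?lee_fin ?mulr_ge0 ?powR_ge0 ?invr_ge0 ?exprn_ge0//.
by apply: integral_ge0 => z _; rewrite lee_fin powR_ge0.
Qed.

Lemma cube_grad_le x h (s : R) : (0 < h)%R -> (0 < s)%R ->
  cube_gradp x h <= (s `^ p)%:E -> cube_grad f x h <= (2 * s)%:E.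
Proof.
move=> h0 s0 Bs; have hn0 : (0 < h ^+ n)%R by rewrite exprn_gt0.
have H : \int[mu]_(z in cube x h) (grad1 f z)%:E <= (2 * h ^+ n * (s / h))%:E.
  apply: (@integral_le_mean _ _ _ mu _ _ _ _ p) => //.
  - exact: measurable_box.
  - exact: lebesgue_rV_cube.
  - by rewrite divr_gt0.
  - exact: ltW.
  - by apply: measurable_funTS; exact: measurable_grad1.
  - exact: grad1_ge0.
  - have hp0 : (0 < h `^ p)%R by rewrite powR_gt0.
    have c0 : 0 <= (h ^+ n * (h `^ p)^-1)%:E.
      by rewrite lee_fin mulr_ge0 ?invr_ge0 ?(ltW hn0) ?(ltW hp0).
    have := lee_wpmul2l c0 Bs.
    rewrite /cube_gradp muleA -!EFinM.
    rewrite (_ : h ^+ n / h `^ p * (h `^ p * h ^- n) = 1)%R; last first.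
      by field; rewrite !gt_eqF.
    by rewrite mul1e powRM ?invr_ge0 ?(ltW s0) ?(ltW h0)// powRV ?(ltW h0)// mulrA mulrAC.
apply: (le_trans (lee_wpmul2l _ H)).
  by rewrite lee_fin mulr_ge0 ?invr_ge0 ?(ltW h0) ?(ltW hn0).
rewrite -EFinM lee_fin le_eqVlt; apply/orP; left; apply/eqP.
by field; rewrite !gt_eqF.
Qed.

(** Pulls the p-th power into the series. Each term of the weighted series is at most its sum [S],
    hence [cube_grad] at scale [k] is at most a constant times [S]^ p^-1 * t ^+ k[, and these bounds
    are summable. The weights](t ^- k) [^ p] are the price of summability. *)
Lemma powR_le_cube_gradp_series x (i : 'I_n) (t : R) :
  (`|x ord0 i| < M)%R -> (0 < t < 1)%R ->
  (`|f x| `^ p)%:E <= ((2 ^+ n.+1 / (1 - t)) `^ p)%:E *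
    \sum_(k <oo) ((t ^- k) `^ p)%:E * cube_gradp x (4 * M / 2 ^+ k).
Proof.
move=> xM /andP[t0 t1]; set c := (2 ^+ n.+1 / (1 - t))%R.
have h0 k : (0 < 4 * M / 2 ^+ k)%R by rewrite divr_gt0 ?exprn_gt0// mulr_gt0.
have c0 : (0 < c)%R by rewrite divr_gt0 ?exprn_gt0// subr_gt0.
have B0 k : 0 <= ((t ^- k) `^ p)%:E * cube_gradp x (4 * M / 2 ^+ k).
  by rewrite mule_ge0 ?lee_fin ?powR_ge0// cube_gradp_ge0// ltW.
set S := \sum_(k <oo) _.
have S0 : 0 <= S by apply: nneseries_ge0.
have p0 : (0 < p)%R := lt_trans ltr01 p1.
have [Sy|Sy] := eqVneq S +oo.
  by rewrite Sy gt0_muley ?leey// lte_fin powR_gt0.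
have [s sE] : exists s : R, S = s%:E.
  by exists (fine S); rewrite fineK// ge0_fin_numE// ltey.
have s0 : (0 <= s)%R by rewrite -lee_fin -sE.
rewrite sE -EFinM; apply/lee_addgt0Pr => e e0; rewrite -EFinD lee_fin.
pose s' := (s + e / c `^ p)%R.
have s'0 : (0 < s')%R by rewrite ltr_wpDl// divr_gt0// powR_gt0.
suff fc : (`|f x| <= c * s' `^ p^-1)%R.
  rewrite (@le_trans _ _ ((c * s' `^ p^-1) `^ p)%R)//.
    by rewrite ler_powR2// ltW.
  rewrite powRM ?powR_ge0 ?(ltW c0)// powRVK ?gt_eqF ?(ltW s'0)//.
  by rewrite mulrDr [(c `^ p * (e / _))%R]mulrC divfK// gt_eqF// powR_gt0.
have P k : cube_grad f x (4 * M / 2 ^+ k) <= (2 * s' `^ p^-1 * t ^+ k)%:E.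
  rewrite -[(2 * _ * _)%R]mulrA; apply: cube_grad_le => //.
    by rewrite mulr_gt0 ?powR_gt0// exprn_gt0.
  have tk0 : (0 < t ^+ k)%R by rewrite exprn_gt0.
  rewrite powRM ?powR_ge0 ?(ltW tk0)// powRVK ?gt_eqF ?(ltW s'0)//.
  have : ((t ^- k) `^ p)%:E * cube_gradp x (4 * M / 2 ^+ k) <= s'%:E.
    apply: (@le_trans _ _ S); last first.
      by rewrite sE lee_fin lerDl divr_ge0 ?powR_ge0 ?(ltW e0).
    rewrite /S (@nneseriesD1 _ _ k)//; rewrite leeDl//.
    exact: nneseries_ge0.
  have tkp : 0 <= ((t ^+ k) `^ p)%:E by rewrite lee_fin powR_ge0.
  move=> /(lee_wpmul2l tkp); rewrite muleA -EFinM -EFinM.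
  rewrite -powRM ?invr_ge0 ?(ltW tk0)// divff ?gt_eqF// powR1 mul1e.
  by rewrite [(s' * _)%R]mulrC.
rewrite -lee_fin; apply: (le_trans (le_cube_grad_series cf cdf df M0 f_out xM)).
apply: (@le_trans _ _ ((2 ^+ n)%:E * (2 * s' `^ p^-1 / (1 - t))%:E)).
  rewrite lee_wpmul2l ?lee_fin ?exprn_ge0//.
  apply: le_trans; last first.
    apply: nneseries_geometric_le; first by rewrite mulr_ge0// powR_ge0.
    by rewrite t0 t1.
  apply: lee_nneseries => // k _ _; apply: cube_grad_ge0; exact: ltW.
rewrite -EFinM lee_fin /c exprSr le_eqVlt; apply/orP; left; apply/eqP.
by field; rewrite subr_eq0 gt_eqF.
Qed.

End pointwise_bound.

Section trace_test.
Context {R : realType} {n : nat}.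
Implicit Types (x z : 'rV[R]_n) (h : R).
Let mu := lebesgue_rV (R := R) n.
Local Open Scope ereal_scope.

Lemma measurable_cubes h :
  measurable [set xz : 'rV[R]_n * 'rV[R]_n | cube xz.1 h xz.2].
Proof.
rewrite (_ : mkset _ = \bigcap_(i in [set: 'I_n])
   ((fun xz : 'rV[R]_n * 'rV[R]_n => (rV_coord i xz.2 - rV_coord i xz.1)%R)
     @^-1` `[0%R, h[%classic)).
  apply: fin_bigcap_measurable => // i _; rewrite -[X in measurable X]setTI.
  have mB : measurable_fun setT
      (fun xz : 'rV[R]_n * 'rV[R]_n => (rV_coord i xz.2 - rV_coord i xz.1)%R).
    apply: measurable_funB; apply: measurableT_comp => //; exact: measurable_rV_coord.
  exact: mB.
apply/seteqP; split => [[x z] /= xz i _|[x z] /= xz i].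
  by have := xz i; rewrite /= in_itv/= /rV_coord subr_ge0 ltrBlDl.
by have := xz i I; rewrite /= in_itv/= /rV_coord subr_ge0 ltrBlDl.
Qed.

(** The corners of the cubes that contain [z] again form a cube, of volume [h ^+ n]; it is the
    domain of the inner integral once Tonelli's theorem has been applied. *)
Lemma measurable_cocube z h : measurable [set x | cube x h z].
Proof.
rewrite (_ : mkset _ = ysection [set xz : 'rV[R]_n * 'rV[R]_n | cube xz.1 h xz.2] z).
  by apply: measurable_ysection; exact: measurable_cubes.
by apply/seteqP; split => x /=; rewrite /ysection/= inE.
Qed.

Lemma lebesgue_rV_cocube z h : (0 < h)%R ->
  mu [set x | cube x h z] = (h ^+ n)%:E.
Proof.
move=> h0.
have -> : [set x | cube x h z] =
    [set x | forall i, `]z ord0 i - h, z ord0 i]%classic%R (x ord0 i)].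
  apply/seteqP; split => x /= xz i; have := xz i;
    by rewrite /= in_itv/= ltrBlDr andbC.
rewrite /mu (@lebesgue_rV_box _ _ (fun i => `]z ord0 i - h, z ord0 i]%classic%R))//.
rewrite (eq_bigr (fun=> h%:E)) => [|i _].
  by rewrite prodEFin prodr_const card_ord.
by rewrite lebesgue_measure_itv/= lte_fin ltrBlDr ltrDl h0 -EFinB subKr.
Qed.

Variables (p q : R).
Hypothesis q1 : (1 <= q)%R.

Let beta : R := p - n%:R / q.

Section weight.
Variables (W : 'rV[R]_n -> R) (K : R).
Hypotheses (mW : measurable_fun setT W) (W0 : forall x, (0 <= W x)%R).
Hypotheses (K0 : (0 < K)%R) (WK : \int[mu]_x (W x `^ q)%:E <= (K `^ q)%:E).

Lemma integral_cocube_le z h : (0 < h)%R ->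
  \int[mu]_(x in [set x | cube x h z]) (W x)%:E <=
  (2 * h ^+ n * (K * h `^ (- (n%:R / q))))%:E.
Proof.
move=> h0; have q0 : (0 < q)%R by rewrite (lt_le_trans ltr01).
apply: (@integral_le_mean _ _ _ mu _ _ _ _ q) => //.
- exact: measurable_cocube.
- exact: lebesgue_rV_cocube.
- by rewrite mulr_gt0// powR_gt0.
- exact: measurable_funTS.
rewrite powRM ?powR_ge0 ?(ltW K0)// -powRrM mulNr divfK ?gt_eqF//.
rewrite powRN powR_mulrn ?(ltW h0)// mulrC divfK ?expf_neq0 ?gt_eqF//.
apply: le_trans WK; apply: ge0_subset_integral => //.
- exact: measurable_cocube.
- by apply/measurable_EFinP; exact: (measurableT_comp (measurable_powR q)).
- by move=> x _; rewrite lee_fin powR_ge0.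
Qed.

Variable f : 'rV[R]_n -> R.
Hypotheses (cdf : forall i, continuous (partial i f)).

Let mFp : measurable_fun setT (fun z => grad1 f z `^ p)%R.
Proof.
by apply: (measurableT_comp (measurable_powR p)); exact: measurable_grad1.
Qed.

(** The joint integrand extended by zero, so that the dependence of the cube on its corner becomes a
    measurable set of the product space. *)
Let kernel h : 'rV[R]_n * 'rV[R]_n -> \bar R :=
  (fun xz => (W xz.1 * grad1 f xz.2 `^ p)%:E) \_
    [set xz : 'rV[R]_n * 'rV[R]_n | cube xz.1 h xz.2].

Let mkernel h : measurable_fun setT (kernel h).
Proof.
apply/(measurable_restrictT _ _).1; first exact: measurable_cubes.
apply: measurable_funTS; apply/measurable_EFinP; apply: measurable_funM.
  exact: (measurableT_comp mW).
exact: (measurableT_comp mFp).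
Qed.

Let kernel_ge0 h xz : 0 <= kernel h xz.
Proof.
by rewrite /kernel /patch; case: ifP => // _; rewrite lee_fin mulr_ge0 ?powR_ge0.
Qed.

Let weighted_cube_gradpE h x : (W x)%:E * cube_gradp f p x h =
  (h `^ p * h ^- n)%:E * \int[mu]_z kernel h (x, z).
Proof.
rewrite /cube_gradp muleCA; congr (_ * _).
rewrite -ge0_integralZl_EFin//; last 3 first.
- exact: measurable_box.
- by move=> z _; rewrite lee_fin powR_ge0.
- by apply: measurable_funTS; exact/measurable_EFinP.
rewrite integral_mkcond; apply: eq_integral => z _.
rewrite /kernel /patch; congr (if _ then _ else _).
Qed.

Lemma measurable_weighted_cube_gradp h :
  measurable_fun setT (fun x => (W x)%:E * cube_gradp f p x h).
Proof.
under eq_fun do rewrite weighted_cube_gradpE.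
by apply: measurable_funeM; exact: measurable_fun_fubini_tonelli_F.
Qed.

(** For fixed [z] the weight is integrated over the corners of the cubes through [z]. The powers
    combine to [beta]: p - n from the normalization, n - n/q from the mean of the weight. *)
Lemma integral_weighted_cube_gradp h : (0 < h)%R ->
  \int[mu]_x ((W x)%:E * cube_gradp f p x h) <=
  (2 * K * h `^ beta)%:E * \int[mu]_z (grad1 f z `^ p)%:E.
Proof.
move=> h0; have hn0 : (0 < h ^+ n)%R by rewrite exprn_gt0.
have c0 : (0 <= h `^ p * h ^- n)%R by rewrite mulr_ge0 ?powR_ge0// invr_ge0 ltW.
under eq_integral do rewrite weighted_cube_gradpE.
rewrite ge0_integralZl_EFin//; last 2 first.
- by move=> x _; exact: integral_ge0.
- exact: measurable_fun_fubini_tonelli_F.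
rewrite fubini_tonelli//.
pose s := (2 * h ^+ n * (K * h `^ (- (n%:R / q))))%R.
have s0 : (0 <= s)%R by rewrite !mulr_ge0 ?powR_ge0 ?(ltW K0) ?(ltW hn0).
apply: (@le_trans _ _ ((h `^ p * h ^- n)%:E *
    (s%:E * \int[mu]_z (grad1 f z `^ p)%:E))); last first.
  rewrite muleA -EFinM lee_wpmul2r//.
    by apply: integral_ge0 => z _; rewrite lee_fin powR_ge0.
  rewrite lee_fin /s /beta powRD ?(gt_eqF h0) ?implybT//.
  rewrite le_eqVlt; apply/orP; left; apply/eqP.
  by field; rewrite gt_eqF.
rewrite lee_wpmul2l ?lee_fin//.
rewrite -ge0_integralZl_EFin//; last 2 first.
- by move=> z _; rewrite lee_fin powR_ge0.
- exact/measurable_EFinP.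
apply: ge0_le_integral => //.
- by move=> z _; apply: integral_ge0.
- exact: measurable_fun_fubini_tonelli_G.
- by apply: measurable_funeM; exact/measurable_EFinP.
move=> z _.
have -> : \int[mu]_x kernel h (x, z) =
    (grad1 f z `^ p)%:E * \int[mu]_(x in [set x | cube x h z]) (W x)%:E.
  rewrite -ge0_integralZl_EFin ?powR_ge0//; last 3 first.
  - exact: measurable_cocube.
  - by move=> x _; rewrite lee_fin.
  - by apply: measurable_funTS; exact/measurable_EFinP.
  rewrite [RHS]integral_mkcond; apply: eq_integral => x _.
  rewrite /kernel /patch -EFinM mulrC; congr (if _ then _ else _).
rewrite muleC lee_wpmul2r ?lee_fin ?powR_ge0//.
exact: integral_cocube_le.
Qed.

End weight.

End trace_test.

Section trace_smooth.
Context {R : realType} {n : nat}.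
Let mu := lebesgue_rV (R := R) n.
Local Open Scope ereal_scope.

Lemma trace_inequality_smooth (p q M : R) : (0 < n)%N -> (1 < p)%R ->
  (1 <= q)%R -> (n%:R / q < p)%R -> (0 < M)%R ->
  exists2 C : R, (0 < C)%R & forall (f W : 'rV[R]_n -> R) (K : R),
    continuous f -> (forall i, continuous (partial i f)) ->
    (forall i x, derivable f x (delta_mx ord0 i)) ->
    (forall x, f x != 0%R -> forall i, (`|x ord0 i| < M)%R) ->
    measurable_fun setT W -> (forall x, (0 <= W x)%R) ->
    (forall x, W x != 0%R -> forall i, (`|x ord0 i| < M)%R) ->
    (0 < K)%R -> \int[mu]_x (W x `^ q)%:E <= (K `^ q)%:E ->
    \int[mu]_x (W x * `|f x| `^ p)%:E <=
    (C * K)%:E * \int[mu]_x (grad1 f x `^ p)%:E.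
Proof.
move=> n0 p1 q1 npq M0; have p0 : (0 < p)%R := lt_trans ltr01 p1.
pose beta := (p - n%:R / q)%R; have beta0 : (0 < beta)%R by rewrite subr_gt0.
pose rho : R := (2 `^ (- (beta / 2)))%R.
have rho0 : (0 < rho)%R by rewrite powR_gt0.
have rho1 : (rho < 1)%R.
  rewrite /rho powRN invf_lt1 ?powR_gt0//.
  have b20 : (0 < beta / 2)%R by rewrite divr_gt0.
  have /(_ 1%R 2%R) := gt0_ltr_powR b20.
  by rewrite powR1; apply; rewrite ?nnegrE// ltr1n.
pose t := (rho `^ p^-1)%R.
have t01 : (0 < t < 1)%R.
  have p'0 : (0 < p^-1)%R by rewrite invr_gt0.
  rewrite powR_gt0//=; have /(_ rho 1%R) := gt0_ltr_powR p'0.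
  by rewrite powR1; apply; rewrite ?nnegrE// ltW.
have t_p : (t `^ p = rho)%R by rewrite powRVK ?gt_eqF// ltW.
have rho2 : (rho ^+ 2 = (2 `^ beta)^-1)%R.
  rewrite -powR_mulrn ?powR_ge0// -powRrM -powRN; congr (_ `^ _)%R.
  by rewrite mulNr divfK.
pose c := ((2 ^+ n.+1 / (1 - t)) `^ p)%R.
have c0 : (0 < c)%R.
  by rewrite powR_gt0// divr_gt0 ?exprn_gt0// subr_gt0; case/andP: t01.
pose H := (4 * M)%R; have H0 : (0 < H)%R by rewrite mulr_gt0.
exists (c * (2 * H `^ beta / (1 - rho)))%R.
  by rewrite mulr_gt0// divr_gt0 ?subr_gt0// mulr_gt0// powR_gt0.
move=> f W K cf cdf df f_out mW W0 W_out K0 WK.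
set J := \int[mu]_x (grad1 f x `^ p)%:E.
have J0 : 0 <= J by apply: integral_ge0 => x _; rewrite lee_fin powR_ge0.
have [Jy|Jfin] := eqVneq J +oo.
  rewrite Jy gt0_muley ?leey// lte_fin mulr_gt0// mulr_gt0// divr_gt0 ?subr_gt0//.
  by rewrite mulr_gt0// powR_gt0.
have [j jE] : exists j : R, J = j%:E.
  by exists (fine J); rewrite fineK// ge0_fin_numE// ltey.
have j0 : (0 <= j)%R by rewrite -lee_fin -jE.
have h0 k : (0 < H / 2 ^+ k)%R by rewrite divr_gt0// exprn_gt0.
pose u k x := ((t ^- k) `^ p)%:E * ((W x)%:E * cube_gradp f p x (H / 2 ^+ k)).
have u0 k x : 0 <= u k x.
  rewrite /u mule_ge0 ?lee_fin ?powR_ge0// mule_ge0 ?lee_fin// cube_gradp_ge0//.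
  exact: ltW.
have mu_ k : measurable_fun setT (u k).
  by apply: measurable_funeM; exact: measurable_weighted_cube_gradp.
apply: (@le_trans _ _ (\int[mu]_x (c%:E * \sum_(k <oo) u k x))).
  apply: ge0_le_integral => //.
  - by move=> x _; rewrite lee_fin mulr_ge0 ?powR_ge0.
  - apply/measurable_EFinP; apply: measurable_funM => //.
    apply: (measurableT_comp (measurable_powR p)); apply: measurableT_comp => //.
    exact: continuous_measurable_rV.
  - apply: measurable_funeM; apply: ge0_emeasurable_sum => //.
  (* The pointwise bound holds for [x] with a coordinate below [M] in absolute value; elsewhere the
     weight vanishes. The positive dimension supplies the coordinate. *)
  move=> x _; have [Wx0|Wx0] := eqVneq (W x) 0%R.
    rewrite Wx0 mul0r mule_ge0// ?lee_fin ?(ltW c0)//.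
    by apply: nneseries_ge0.
  rewrite EFinM (eq_eseriesr (g := fun k => (W x)%:E *
      (((t ^- k) `^ p)%:E * cube_gradp f p x (H / 2 ^+ k)))); last first.
    by move=> k _; rewrite /u muleCA.
  rewrite nneseriesZl; last first.
    by move=> k _; rewrite mule_ge0 ?lee_fin ?powR_ge0// cube_gradp_ge0// ltW.
  rewrite muleCA lee_wpmul2l ?lee_fin//.
  exact: (powR_le_cube_gradp_series cf cdf df M0 p1 f_out (W_out x Wx0 (Ordinal n0))).
rewrite ge0_integralZl_EFin//; last 3 first.
- by move=> x _; exact: nneseries_ge0.
- by apply: ge0_emeasurable_sum.
- exact: ltW.
rewrite integral_nneseries// -mulrA EFinM -muleA lee_wpmul2l ?lee_fin ?(ltW c0)//.
apply: (@le_trans _ _ (\sum_(k <oo) (2 * K * H `^ beta * j * rho ^+ k)%:E)).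
  apply: lee_nneseries => [k _ _|k _]; first exact: integral_ge0.
  rewrite /u ge0_integralZl_EFin ?powR_ge0//; last 2 first.
  - by move=> x _; rewrite mule_ge0 ?lee_fin// cube_gradp_ge0// ltW.
  - exact: measurable_weighted_cube_gradp.
  have tk0 : 0 <= ((t ^- k) `^ p)%:E by rewrite lee_fin powR_ge0.
  apply: (le_trans (lee_wpmul2l tk0
    (integral_weighted_cube_gradp p q1 mW W0 K0 WK cdf (h0 k)))).
  rewrite -/J jE -!EFinM lee_fin le_eqVlt; apply/orP; left; apply/eqP.
  have rk0 : (0 < rho ^+ k)%R by rewrite exprn_gt0.
  have -> : ((t ^- k) `^ p = rho ^- k)%R.
    by rewrite powRV ?exprn_ge0 ?powR_ge0// powRX ?powR_ge0// t_p.
  have -> : ((H / 2 ^+ k) `^ beta = H `^ beta * (rho ^+ k) ^+ 2)%R.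
    rewrite powRM ?invr_ge0 ?exprn_ge0 ?(ltW H0)// powRV ?exprn_ge0// powRX//.
    by rewrite -exprVn -rho2 exprAC.
  by field; rewrite gt_eqF.
apply: (le_trans (nneseries_geometric_le _ _)).
- by rewrite !mulr_ge0 ?powR_ge0 ?(ltW K0).
- by rewrite rho0 rho1.
rewrite jE -EFinM lee_fin le_eqVlt; apply/orP; left; apply/eqP.
by field; rewrite subr_eq0 gt_eqF.
Qed.

End trace_smooth.

(** * The trace inequality on the Sobolev space *)

Section powR_inequalities.
Context {R : realType}.
Implicit Types (x y r : R).

Lemma powRD_le x y r : 0 <= r -> 0 <= x -> 0 <= y ->
  (x + y) `^ r <= 2 `^ r * (x `^ r + y `^ r).
Proof.
move=> r0; wlog xy : x y / x <= y => [H x0 y0|x0 y0].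
  have [xy|/ltW yx] := leP x y; first exact: H.
  by rewrite addrC [x `^ r + _]addrC; exact: H.
rewrite (@le_trans _ _ ((2 * y) `^ r))//.
  by rewrite ler_powR2 ?addr_ge0// mulr_natl mulr2n lerD2r.
by rewrite powRM// ler_wpM2l ?powR_ge0// lerDr powR_ge0.
Qed.

Lemma powR_sum_le n (a : 'I_n -> R) r : 0 < r -> (forall i, 0 <= a i) ->
  (\sum_i a i) `^ r <= n%:R `^ r * \sum_i a i `^ r.
Proof.
move=> r0 a0; set S := \sum_i a i `^ r.
have S0 : 0 <= S by apply: sumr_ge0 => i _; exact: powR_ge0.
have aS i : a i <= S `^ r^-1.
  rewrite -[leLHS](@powRK _ r) ?gt_eqF//; apply: ler_powR2.
  - by rewrite invr_ge0 ltW.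
  - exact: powR_ge0.
  - by rewrite /S (bigD1 i)//= lerDl sumr_ge0// => j _; exact: powR_ge0.
have aS' : \sum_i a i <= n%:R * S `^ r^-1.
  rewrite mulr_natl -[in leRHS](card_ord n) -sumr_const; exact: ler_sum.
apply: le_trans (ler_powR2 (ltW r0) _ aS') _; first exact: sumr_ge0.
by rewrite powRM ?powR_ge0// powRVK ?gt_eqF.
Qed.

End powR_inequalities.

Section Lp_domain.
Context {R : realType} {N : nat}.
Variable Om : set 'rV[R]_N.
Hypothesis mOm : measurable Om.
Let mu := lebesgue_rV (R := R) N.
Local Open Scope ereal_scope.

Lemma normLp_ge0 r u : 0 <= normLp Om r u.
Proof. exact: Lnorm_ge0. Qed.

Lemma poweR_normLp (r : R) u : r != 0%R ->
  normLp Om r%:E u `^ r = \int[mu]_(x in Om) (`|u x| `^ r)%:E.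
Proof.
move=> r0; rewrite [RHS]integral_mkcond.
rewrite /normLp poweR_Lnorm//.
apply: eq_integral => x _.
rewrite /= /patch; case: ifPn => // _.
by rewrite normr0 powR0.
Qed.

Lemma in_LpP (r : R) u : (0 < r)%R -> in_Lp Om r%:E u <->
  measurable_fun Om u /\ \int[mu]_(x in Om) (`|u x| `^ r)%:E < +oo.
Proof.
move=> r0; rewrite /in_Lp inE; split.
  move=> /andP[]; rewrite !inE/= => mu_ fu; split.
    exact/(measurable_restrictT _ mOm).
  by rewrite -poweR_normLp ?gt_eqF//; exact: poweR_lty.
move=> [mu_ fu]; apply/andP; rewrite !inE/=; split.
  exact/(measurable_restrictT _ mOm).
by apply: (@lty_poweRy _ _ r); rewrite ?gt_eqF// (poweR_normLp u) ?gt_eqF.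
Qed.

Lemma integral_powR_normLp_cvg0 (r : R) (u : nat -> 'rV[R]_N -> R) : (0 < r)%R ->
  normLp Om r%:E (u k) @[k --> \oo] --> 0 -> forall eps : R, (0 < eps)%R ->
  \forall k \near \oo, \int[mu]_(x in Om) (`|u k x| `^ r)%:E <= eps%:E.
Proof.
move=> r0 u0 eps eps0.
have e'0 : (0 < eps `^ r^-1)%R by rewrite powR_gt0.
have : \forall k \near \oo, normLp Om r%:E (u k) < (eps `^ r^-1)%:E.
  have e'0E : 0 < (eps `^ r^-1)%:E by rewrite lte_fin.
  exact: (u0 _ (open_ereal_lt' e'0E)).
apply: filterS => k uk; rewrite -poweR_normLp ?gt_eqF//.
rewrite -[leRHS](_ : ((eps `^ r^-1)%:E) `^ r = _); last first.
  by rewrite poweR_EFin powRVK ?gt_eqF// ltW.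
apply: gt0_ler_poweR; rewrite ?ltW// in_itv/= leey andbT ?normLp_ge0//.
by rewrite lee_fin ltW.
Qed.

Lemma normr_le_enorm (v : 'rV[R]_N) i : (`|v ord0 i| <= enorm v)%R.
Proof.
rewrite -sqrtr_sqr ler_sqrt; last first.
  by rewrite sumr_ge0// => j _; rewrite -expr2 sqr_ge0.
rewrite /dotv (bigD1 i)//= expr2 lerDl sumr_ge0// => j _.
by rewrite -expr2 sqr_ge0.
Qed.

Lemma enorm_ge0 (v : 'rV[R]_N) : (0 <= enorm v)%R.
Proof. exact: sqrtr_ge0. Qed.

Lemma enorm_le_sum (v : 'rV[R]_N) : (enorm v <= \sum_i `|v ord0 i|)%R.
Proof.
have S0 : (0 <= \sum_i `|v ord0 i|)%R by exact: sumr_ge0.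
rewrite -(ger0_norm S0) -sqrtr_sqr ler_sqrt ?sqr_ge0// expr2 mulr_suml.
apply: ler_sum => i _; apply: le_trans (ler_norm _) _.
rewrite normrM ler_wpM2l// (bigD1 i)//= lerDl; exact: sumr_ge0.
Qed.

Lemma measurable_enorm (Du : 'rV[R]_N -> 'rV[R]_N) :
  (forall i, measurable_fun Om (fun x => Du x ord0 i)) ->
  measurable_fun Om (fun x => enorm (Du x)).
Proof.
move=> mDu; have mS : measurable_fun Om (fun x => dotv (Du x) (Du x)).
  by apply: measurable_sum => i; apply: measurable_funM.
apply: eq_measurable_fun (measurableT_comp (measurable_powR 2^-1%R) mS).
move=> x _; rewrite /= powR12_sqrt// sumr_ge0// => i _.
by rewrite -expr2 sqr_ge0.
Qed.

End Lp_domain.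

Section test_functions.
Context {R : realType} {N : nat}.
Variable Om : set 'rV[R]_N.

Lemma test_function_C1 phi : test_function Om phi ->
  [/\ continuous phi, forall i, continuous (partial i phi) &
      forall i x, derivable phi x (delta_mx ord0 i)].
Proof.
move=> [sm _ _]; have [c0 d0] := sm [::].
by split => [//|i|//]; have [] := sm [:: i].
Qed.

Lemma test_function_out phi x : test_function Om phi -> ~ Om x -> phi x = 0.
Proof.
move=> [_ _ sOm] Omx; apply/eqP; apply: contrapT => /negP phix.
by apply: Omx; apply: sOm; exact: subset_closure.
Qed.

(** The complement of the support is open, so [phi] vanishes in a whole neighbourhood of [x]. *)
Lemma test_function_partial_out phi i x : test_function Om phi -> ~ Om x ->
  partial i phi x = 0.
Proof.
move=> [_ _ sOm] Omx; rewrite /partial.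
rewrite (@near_eq_derive _ _ _ _ (cst 0)) ?derive_cst//.
have : nbhs x (~` closure [set x | phi x != 0]).
  apply: open_nbhs_nbhs; split; last by move=> /sOm.
  by apply: closed_openC; exact: closed_closure.
apply: filterS => y /= phiy; apply/eqP; apply: contrapT => /negP phiy0.
by apply: phiy; exact: subset_closure.
Qed.

Lemma bounded_set_coord (A : set 'rV[R]_N) : bounded_set A ->
  exists2 M : R, 0 < M & forall x, A x -> forall i, `|x ord0 i| < M.
Proof.
move=> [M [_ AM]]; pose M' := Num.max M 0 + 1.
have M'0 : 0 < M' by rewrite ltr_wpDl// le_max lexx orbT.
have MM' : M < M' by rewrite ltr_pwDr// le_max lexx.
have M1 : 0 < M' + 1 by rewrite addr_gt0.
exists (M' + 1) => // x Ax i.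
have : ball 0 (M' + 1) x.
  by rewrite mx_norm_ball /ball_ /= sub0r normrN (le_lt_trans (AM _ MM' _ Ax))// ltrDl.
by rewrite (ball_rVE _ _ M1) => /(_ i); rewrite mxE sub0r normrN.
Qed.

End test_functions.

(** Monotone convergence along truncations of the weight. A bounded weight allows passing from test
    functions to their limit in L^p, and makes integrals over a bounded domain finite. *)
Lemma integral_min_le d (T : measurableType d) (R : realType)
    (mu : {measure set T -> \bar R}) (D : set T) (W F : T -> R) (b : \bar R) :
  measurable D -> measurable_fun D W -> measurable_fun D F ->
  (forall x, D x -> 0 <= W x) -> (forall x, D x -> 0 <= F x) ->
  (forall m : nat, \int[mu]_(x in D) (Num.min (W x) m.+1%:R * F x)%:E <= b)%E ->
  (\int[mu]_(x in D) (W x * F x)%:E <= b)%E.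
Proof.
move=> mD mW mF W0 F0 H.
have cvgx x : D x ->
    (Num.min (W x) m.+1%:R * F x)%:E @[m --> \oo] --> (W x * F x)%:E.
  move=> Dx; apply: cvg_near_cst.
  near=> m; rewrite (min_idPl _)//.
  by rewrite (le_trans (ltW (truncnS_gt (W x))))// ler_nat ltnS; near: m; exact: nbhs_infty_ge.
rewrite (eq_integral (fun x => limn (fun m => (Num.min (W x) m.+1%:R * F x)%:E))); last first.
  by move=> x /set_mem Dx; apply/esym/cvg_lim => //; exact: cvgx.
rewrite monotone_convergence//; last 3 first.
- move=> m; apply/measurable_EFinP/measurable_funM => //.
  by apply: measurable_minr.
- by move=> m x Dx; rewrite lee_fin mulr_ge0 ?F0// le_min W0//=.
- move=> x Dx m k mk; rewrite lee_fin ler_wpM2r ?F0//.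
  by rewrite le_min2// ler_nat ltnS.
apply: lime_le; last exact: nearW.
apply: ereal_nondecreasing_is_cvgn => m k mk; apply: ge0_le_integral => //.
- by move=> x Dx; rewrite lee_fin mulr_ge0 ?F0// le_min W0//=.
- by apply/measurable_EFinP/measurable_funM => //; apply: measurable_minr.
- by apply/measurable_EFinP/measurable_funM => //; apply: measurable_minr.
- move=> x Dx; rewrite lee_fin ler_wpM2r ?F0//.
  by rewrite le_min2// ler_nat ltnS.
Unshelve. all: by end_near. Qed.

Section trace_sobolev.
Context {R : realType} {N : nat}.
Variable Om : set 'rV[R]_N.
Hypotheses (oOm : open Om) (bOm : bounded_set Om) (N0 : (0 < N)%N).
Let mu := lebesgue_rV (R := R) N.
Variables (p q : R).
Hypotheses (p1 : 1 < p) (pq : admissible_exponent N p q).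
Implicit Types (u : 'rV[R]_N -> R) (Du : 'rV[R]_N -> 'rV[R]_N).
Local Open Scope ereal_scope.

Let mOm : measurable Om. Proof. exact: open_measurable_rV. Qed.
Let p0 : (0 < p)%R. Proof. exact: lt_trans ltr01 p1. Qed.

Lemma admissible_exponent_ge1 : (1 <= q)%R.
Proof.
case: pq => H1 H2; have [pN|Np] := leP p N%:R; last by rewrite H2.
by rewrite (le_trans _ (ltW (H1 pN)))// ler_pdivlMr// mul1r.
Qed.

Let q0 : (0 < q)%R. Proof. exact: lt_le_trans ltr01 admissible_exponent_ge1. Qed.

(** The two cases in the choice of [q] give the same inequality, which is what makes the exponent
    [beta] of the trace estimate positive. *)
Lemma admissible_exponent_lt : (N%:R / q < p)%R.
Proof.
rewrite ltr_pdivrMr// mulrC.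
case: pq => H1 H2; have [pN|Np] := leP p N%:R; last by rewrite H2// mul1r.
by rewrite -ltr_pdivrMr// H1.
Qed.

Definition dirichlet_energy Du := \int[mu]_(x in Om) (enorm (Du x) `^ p)%:E.

Lemma dirichlet_energy_ge0 Du : 0 <= dirichlet_energy Du.
Proof. by apply: integral_ge0 => x _; rewrite lee_fin powR_ge0. Qed.

Lemma W1p_measurable u Du : W1p Om p u Du ->
  measurable_fun Om u /\ forall i, measurable_fun Om (fun x => Du x ord0 i).
Proof.
by move=> [Lu LDu _]; split=> [|i]; [have /(in_LpP mOm _ p0)[] := Lu|
  have /(in_LpP mOm _ p0)[] := LDu i].
Qed.

Lemma measurable_powR_enorm Du : (forall i, measurable_fun Om (fun x => Du x ord0 i)) ->
  measurable_fun Om (fun x => enorm (Du x) `^ p)%R.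
Proof.
by move=> mDu; apply: (measurableT_comp (measurable_powR p)); exact: measurable_enorm.
Qed.

Lemma measurable_powR_norm (r : R) u : measurable_fun Om u ->
  measurable_fun Om (fun x => `|u x| `^ r)%R.
Proof.
by move=> mu_; apply: (measurableT_comp (measurable_powR r)); exact: measurableT_comp.
Qed.

Lemma dirichlet_energy_lty u Du : W1p Om p u Du -> dirichlet_energy Du < +oo.
Proof.
move=> W; have [mu_ mDu] := W1p_measurable W; case: W => _ LDu _.
apply: (@le_lt_trans _ _ ((N%:R `^ p)%:E *
    \sum_(i < N) \int[mu]_(x in Om) (`|Du x ord0 i| `^ p)%:E)).
  rewrite -ge0_integral_sum//; last first.
    by move=> i; apply/measurable_EFinP; exact: measurable_powR_norm.
  rewrite -ge0_integralZl_EFin ?powR_ge0//; last 2 first.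
  - by move=> x _; apply: sume_ge0 => i _; rewrite lee_fin powR_ge0.
  - apply: emeasurable_sum => i; apply/measurable_EFinP; exact: measurable_powR_norm.
  apply: ge0_le_integral => //.
  - by move=> x _; rewrite lee_fin powR_ge0.
  - by apply/measurable_EFinP; exact: measurable_powR_enorm.
  - apply: measurable_funeM; apply: emeasurable_sum => i.
    by apply/measurable_EFinP; exact: measurable_powR_norm.
  move=> x _; rewrite sumEFin -EFinM lee_fin.
  apply: le_trans (powR_sum_le p0 _); last by move=> i; exact: normr_ge0.
  by rewrite ler_powR2 ?enorm_ge0 ?(ltW p0)// enorm_le_sum.
rewrite lte_mul_pinfty ?lee_fin ?powR_ge0//.
by apply: lte_sum_pinfty => i _; have /(in_LpP mOm _ p0)[] := LDu i.
Qed.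

(** Passes from the l^1 norm of the gradient of a test function to the Euclidean norm of a weak
    gradient; the sum on the right is the error that tends to 0 along the approximating sequence. *)
Lemma grad1_powR_le (phi : 'rV[R]_N -> R) Du x :
  (grad1 phi x `^ p <= (2 * N%:R) `^ p * (enorm (Du x) `^ p +
     \sum_i `|partial i phi x - Du x ord0 i| `^ p))%R.
Proof.
set d := fun i => `|partial i phi x - Du x ord0 i|%R.
have d0 i : (0 <= d i)%R by exact: normr_ge0.
have : (grad1 phi x <= N%:R * enorm (Du x) + \sum_i d i)%R.
  rewrite (_ : N%:R * _ = \sum_(i < N) enorm (Du x))%R; last first.
    by rewrite sumr_const card_ord mulr_natl.
  rewrite -big_split/=; apply: ler_sum => i _.
  rewrite -[X in (`|X| <= _)%R](subrK (Du x ord0 i)).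
  by rewrite (le_trans (ler_normD _ _))// [leLHS]addrC lerD2r normr_le_enorm.
move=> /(ler_powR2 (ltW p0) (grad1_ge0 _ _)) /le_trans; apply.
apply: le_trans (powRD_le (ltW p0) _ _) _.
- by rewrite mulr_ge0 ?enorm_ge0.
- exact: sumr_ge0.
rewrite (powRM p (ler0n R 2) (ler0n R N)) -mulrA ler_wpM2l ?powR_ge0// mulrDr lerD//.
  by rewrite powRM ?enorm_ge0.
exact: powR_sum_le.
Qed.

Lemma trace_inequality : exists2 C : R, (0 < C)%R &
  forall u Du (W : 'rV[R]_N -> R) (K : R), W1p0 Om p u Du ->
    measurable_fun setT W -> (forall x, (0 <= W x)%R) ->
    (forall x, W x != 0%R -> Om x) -> (0 < K)%R ->
    \int[mu]_x (W x `^ q)%:E <= (K `^ q)%:E ->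
    \int[mu]_(x in Om) (W x * `|u x| `^ p)%:E <= (C * K)%:E * dirichlet_energy Du.
Proof.
have [M M0 OmM] := bounded_set_coord bOm.
have [C1 C10 trace1] := trace_inequality_smooth N0 p1 admissible_exponent_ge1
  admissible_exponent_lt M0.
have N20 : (0 < 2 * N%:R :> R)%R by rewrite mulr_gt0// ltr0n.
pose c := ((2 * N%:R) `^ p : R)%R; have c0 : (0 < c)%R by rewrite powR_gt0.
have p20 : (0 < (2 : R) `^ p)%R by rewrite powR_gt0.
exists (2 `^ p * C1 * c)%R; first by rewrite !mulr_gt0.
move=> u Du W K [uW [phi [tphi phiu dphi]]] mW W0 WOm K0 WK.
have [mu_ mDu] := W1p_measurable uW.
have mup : measurable_fun Om (fun x => `|u x| `^ p)%R by exact: measurable_powR_norm.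
apply: integral_min_le => //; first exact: measurable_funTS.
move=> m; pose B : R := m.+1%:R.
pose Wm x := Num.min (W x) B.
have Wm0 x : (0 <= Wm x)%R by rewrite le_min W0//=.
have mWm : measurable_fun setT Wm by apply: measurable_minr.
have WmOm x : Wm x != 0%R -> Om x.
  rewrite /Wm => H; apply: WOm; apply: contra H => /eqP ->.
  by rewrite (min_idPl _)//= ler0n.
have WmK : \int[mu]_x (Wm x `^ q)%:E <= (K `^ q)%:E.
  apply: le_trans WK; apply: ge0_le_integral => //.
  - by move=> x _; rewrite lee_fin powR_ge0.
  - by apply/measurable_EFinP; exact: (measurableT_comp (measurable_powR q)).
  - by apply/measurable_EFinP; exact: (measurableT_comp (measurable_powR q)).
  - by move=> x _; rewrite lee_fin ler_powR2 ?(ltW q0)// ge_min lexx.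
rewrite -/B; under eq_integral do rewrite -/(Wm _).
have Ey := dirichlet_energy_lty uW; have E0 := dirichlet_energy_ge0 Du.
have [E EE] : exists E : R, dirichlet_energy Du = E%:E.
  by exists (fine (dirichlet_energy Du)); rewrite fineK// ge0_fin_numE.
rewrite EE -EFinM; apply/lee_addgt0Pr => eps eps0.
(* Collects the coefficients of all approximation errors: if each error is at most [eps / D], they
   add up to [eps]. *)
pose D := (2 `^ p * (C1 * K * c * N%:R + B))%R.
have D0 : (0 < D)%R.
  by rewrite mulr_gt0// addr_gt0 ?mulr_gt0 ?ltr0n.
have e'0 : (0 < eps / D)%R by rewrite divr_gt0.
have near_u := integral_powR_normLp_cvg0 p0 phiu e'0.
have near_du : \forall k \near \oo, forall i, \int[mu]_(x in Om)
    (`|partial i (phi k) x - Du x ord0 i| `^ p)%:E <= (eps / D)%:E.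
  by apply: filter_forall => i; exact: (integral_powR_normLp_cvg0 p0 (dphi i) e'0).
have [k _ /(_ k (leqnn k))[uk duk]] := filterI near_u near_du.
have [cphi cdphi dphik] := test_function_C1 (tphi k).
have mphi : measurable_fun Om (phi k).
  by apply: measurable_funTS; exact: continuous_measurable_rV.
have mdphi i : measurable_fun Om (partial i (phi k)).
  by apply: measurable_funTS; exact: continuous_measurable_rV.
have phi_out x : phi k x != 0%R -> forall i, (`|x ord0 i| < M)%R.
  move=> phix; apply: OmM; apply: contrapT => /(test_function_out (tphi k)) phix0.
  by rewrite phix0 eqxx in phix.
have := trace1 (phi k) Wm K cphi cdphi dphik phi_out mWm Wm0
  (fun x Wx => OmM x (WmOm x Wx)) K0 WmK.
set J := \int[mu]_x (grad1 (phi k) x `^ p)%:E => trk.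
have mdu i : measurable_fun Om (fun x => `|partial i (phi k) x - Du x ord0 i| `^ p)%R.
  by apply: measurable_powR_norm; exact: measurable_funB.
have JE : J <= (c * (E + N%:R * (eps / D)))%:E.
  (* The estimate for test functions integrates over the whole space, whereas [Du] is controlled on
     [Om]; the partial derivatives of [phi k] vanish outside. *)
  rewrite /J (_ : \int[mu]_x _ = \int[mu]_(x in Om) (grad1 (phi k) x `^ p)%:E); last first.
    rewrite [RHS]integral_mkcond; apply: eq_integral => x _.
    rewrite /patch; case: ifPn => // /negP; rewrite inE => Omx.
    rewrite /grad1 big1 ?powR0 ?gt_eqF// => i _.
    by rewrite (test_function_partial_out _ (tphi k))// normr0.
  apply: (@le_trans _ _ (c%:E * (dirichlet_energy Du +
    \sum_(i < N) \int[mu]_(x in Om) (`|partial i (phi k) x - Du x ord0 i| `^ p)%:E))).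
    rewrite /dirichlet_energy -ge0_integral_sum//; last first.
      by move=> i; exact/measurable_EFinP.
    rewrite -ge0_integralD//; last 4 first.
    - by move=> x _; rewrite lee_fin powR_ge0.
    - by apply/measurable_EFinP; exact: measurable_powR_enorm.
    - by move=> x _; apply: sume_ge0 => i _; rewrite lee_fin powR_ge0.
    - by apply: emeasurable_sum => i; exact/measurable_EFinP.
    rewrite -ge0_integralZl_EFin ?(ltW c0)//; last 2 first.
    - move=> x _; rewrite adde_ge0// ?lee_fin ?powR_ge0//.
      by apply: sume_ge0 => i _; rewrite lee_fin powR_ge0.
    - apply: emeasurable_funD; first by apply/measurable_EFinP; exact: measurable_powR_enorm.
      by apply: emeasurable_sum => i; exact/measurable_EFinP.
    apply: ge0_le_integral => //.
    - by move=> x _; rewrite lee_fin powR_ge0.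
    - apply/measurable_EFinP; apply: (measurableT_comp (measurable_powR p)).
      by apply: measurable_funTS; exact: measurable_grad1.
    - apply: measurable_funeM; apply: emeasurable_funD.
        by apply/measurable_EFinP; exact: measurable_powR_enorm.
      by apply: emeasurable_sum => i; exact/measurable_EFinP.
    - move=> x _; rewrite sumEFin -EFinD -EFinM lee_fin; exact: grad1_powR_le.
  rewrite EFinM lee_wpmul2l ?lee_fin ?(ltW c0)// EFinD EE leeD2l//.
  apply: (@le_trans _ _ (\sum_(i < N) (eps / D)%:E)); first by apply: lee_sum => i _; exact: duk.
  by rewrite sumEFin sumr_const card_ord mulr_natl.
have mWphi : measurable_fun setT (fun x => (Wm x * `|phi k x| `^ p)%:E).
  apply/measurable_EFinP/measurable_funM => //.
  apply: (measurableT_comp (measurable_powR p)); apply: measurableT_comp => //.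
  exact: continuous_measurable_rV.
have muk : measurable_fun Om (fun x => (`|phi k x - u x| `^ p)%:E).
  by apply/measurable_EFinP; apply: measurable_powR_norm; exact: measurable_funB.
apply: (@le_trans _ _ (\int[mu]_(x in Om)
   ((2 `^ p)%:E * (Wm x * `|phi k x| `^ p)%:E +
    (2 `^ p * B)%:E * (`|phi k x - u x| `^ p)%:E))).
  apply: ge0_le_integral => //.
  - by move=> x _; rewrite lee_fin mulr_ge0 ?powR_ge0.
  - apply/measurable_EFinP/measurable_funM => //; exact: measurable_funTS.
  - apply: emeasurable_funD; apply: measurable_funeM => //; exact: measurable_funTS.
  move=> x _; rewrite -!EFinM -EFinD lee_fin.
  apply: (@le_trans _ _ (Wm x * (2 `^ p * (`|phi k x| `^ p + `|phi k x - u x| `^ p)))%R).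
    rewrite ler_wpM2l// (le_trans _ (powRD_le (ltW p0) (normr_ge0 _) (normr_ge0 _)))//.
    rewrite ler_powR2 ?(ltW p0)//.
    by rewrite -[X in (`|X| <= _)%R](subKr (phi k x)) ler_normB.
  rewrite mulrCA mulrDr mulrDr lerD2l -mulrA ler_wpM2l ?powR_ge0//.
  by rewrite ler_wpM2r ?powR_ge0// ge_min lexx orbT.
rewrite ge0_integralD//; last 4 first.
- by move=> x _; rewrite -EFinM lee_fin !mulr_ge0 ?powR_ge0.
- by apply: measurable_funeM; exact: measurable_funTS.
- by move=> x _; rewrite -EFinM lee_fin !mulr_ge0 ?powR_ge0.
- exact: measurable_funeM.
rewrite ge0_integralZl_EFin ?powR_ge0//; last 2 first.
- by move=> x _; rewrite lee_fin mulr_ge0 ?powR_ge0.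
- exact: measurable_funTS.
rewrite ge0_integralZl_EFin ?mulr_ge0 ?powR_ge0//.
apply: (@le_trans _ _ ((2 `^ p)%:E * ((C1 * K)%:E * (c * (E + N%:R * (eps / D)))%:E)
    + (2 `^ p * B)%:E * (eps / D)%:E)).
  apply: leeD; last by rewrite lee_wpmul2l// lee_fin mulr_ge0 ?powR_ge0.
  rewrite lee_wpmul2l ?lee_fin ?powR_ge0//.
  apply: (@le_trans _ _ (\int[mu]_x (Wm x * `|phi k x| `^ p)%:E)).
    apply: ge0_subset_integral => //.
    by move=> x _; rewrite lee_fin mulr_ge0 ?powR_ge0.
  by apply: (le_trans trk); rewrite lee_wpmul2l ?lee_fin ?mulr_ge0 ?(ltW C10) ?(ltW K0).
rewrite -!EFinM -!EFinD lee_fin le_eqVlt; apply/orP; left; apply/eqP.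
rewrite (_ : eps = D * (eps / D))%R; last by rewrite mulrC divfK ?gt_eqF.
rewrite [(D * _)%R]mulrC mulfK ?gt_eqF//.
by rewrite /D; ring.
Qed.

End trace_sobolev.

(** * Embedding and Sobolev constants *)

Section embedding.
Context {R : realType} {N : nat}.
Variable Om : set 'rV[R]_N.
Hypotheses (oOm : open Om) (bOm : bounded_set Om).
Let mu := lebesgue_rV (R := R) N.
Variables (p q : R).
Hypotheses (p1 : 1 < p) (pq : admissible_exponent N p q).
Implicit Types (u W : 'rV[R]_N -> R) (Du : 'rV[R]_N -> 'rV[R]_N).
Local Open Scope ereal_scope.

Let mOm : measurable Om. Proof. exact: open_measurable_rV. Qed.
Let p0 : (0 < p)%R. Proof. exact: lt_trans ltr01 p1. Qed.
Let q1 : (1 <= q)%R. Proof. exact: admissible_exponent_ge1 p1 pq. Qed.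
Let q0 : (0 < q)%R. Proof. exact: lt_le_trans ltr01 q1. Qed.

Lemma lebesgue_rV_bounded_lty : mu Om < +oo.
Proof.
have [M M0 OmM] := bounded_set_coord bOm.
have MM0 : (0 < M + M)%R by rewrite addr_gt0.
have : mu Om <= mu (cube (const_mx (- M)%R) (M + M)%R).
  apply: le_measure; rewrite ?inE//; first exact: measurable_box.
  move=> x Omx i; rewrite mxE addKr.
  by have := OmM x Omx i; rewrite ltr_norml => /andP[/ltW -> ->].
have /= -> := lebesgue_rV_cube (const_mx (- M)%R) MM0.
by move=> /le_lt_trans; apply; rewrite ltry.
Qed.

Lemma hoelder_conjugate_EFin : (1 < q)%R ->
  hoelder_conjugate q%:E = (q / (q - 1))%:E.
Proof.
move=> q_gt1; rewrite /hoelder_conjugate/= eqe gt_eqF//.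
by rewrite -EFinB inver subr_eq0 gt_eqF// -EFinM.
Qed.

Lemma conjugate_exponent_finite : (1 < q)%R ->
  p%:E * hoelder_conjugate q%:E = (p * (q / (q - 1)))%:E.
Proof. by move=> q_gt1; rewrite hoelder_conjugate_EFin. Qed.

Lemma conjugate_exponent_infty : q = 1%R -> p%:E * hoelder_conjugate q%:E = +oo.
Proof. by move=> ->; rewrite hoelder_conjugate1 gt0_muley ?lte_fin. Qed.

Lemma conjugate_exponent_ge1 : 1 <= p%:E * hoelder_conjugate q%:E.
Proof.
have [q_gt1|q_le1] := ltP 1%R q; last first.
  by rewrite conjugate_exponent_infty ?leey//; apply/eqP; rewrite eq_le q1 q_le1.
rewrite conjugate_exponent_finite// lee_fin.
have q10 : (0 < q - 1)%R by rewrite subr_gt0.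
rewrite (le_trans (ltW p1))// ler_peMr ?(ltW p0)//.
by rewrite ler_pdivlMr// mul1r lerBlDr lerDl.
Qed.

Lemma measurable_patch u : measurable_fun Om u -> measurable_fun setT (u \_ Om).
Proof. by move=> ?; exact/(measurable_restrictT _ mOm). Qed.

(** The norm with exponent [+oo] is an essential supremum if the whole space has positive measure
    and 0 otherwise, hence the second case, where every property holds almost everywhere. *)
Lemma normLp_inftyP u (L : R) : (0 <= L)%R ->
  (normLp Om +oo u <= L%:E) -> \forall x \ae mu, Om x -> (`|u x| <= L)%R.
Proof.
move=> L0; rewrite /normLp unlock /Lnorm; case: ifPn => [_ /ess_supP|].
  by apply: filterS => x /= + Omx; rewrite /patch mem_set// lee_fin; exact.
rewrite -leNgt => mu0 _; exists setT; split => //.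
by apply/eqP; rewrite eq_le mu0 measure_ge0.
Qed.

Lemma normLp_infty_le u (L : R) : (0 <= L)%R ->
  (\forall x \ae mu, Om x -> (`|u x| <= L)%R) -> normLp Om +oo u <= L%:E.
Proof.
move=> L0 uL; rewrite /normLp unlock /Lnorm; case: ifPn => [_|]; last by rewrite lee_fin.
apply/ess_supP; move: uL; apply: filterS => x /= uL.
rewrite /patch; case: ifPn; last by rewrite normr0 lee_fin.
by rewrite inE => /uL; rewrite lee_fin.
Qed.

(** Hölder's inequality for [W] and the p-th power of [|u|], whose L^{q'} norm is the p-th power of
    the L^{p q'} norm of [u]. For [q = 1] the function is bounded almost everywhere instead. *)
Lemma hoelder_trace u W : measurable_fun Om u -> measurable_fun Om W ->
  (forall x, 0 <= W x)%R ->
  normLp Om (p%:E * hoelder_conjugate q%:E) u < +oo ->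
  \int[mu]_(x in Om) (W x * `|u x| `^ p)%:E <=
  normLp Om q%:E W * normLp Om (p%:E * hoelder_conjugate q%:E) u `^ p.
Proof.
move=> mu_ mW W0; set t := normLp Om _ u => ty.
have mup := measurable_powR_norm p mu_.
have [q_gt1|q_le1] := ltP 1%R q; last first.
  have q1E : q = 1%R by apply/eqP; rewrite eq_le q1 q_le1.
  have t0 : 0 <= t by exact: normLp_ge0.
  have tE : t = (fine t)%:E by rewrite fineK// ge0_fin_numE.
  have ft0 : (0 <= fine t)%R by exact: fine_ge0.
  have ut : \forall x \ae mu, Om x -> (`|u x| <= fine t)%R.
    apply: normLp_inftyP => //; rewrite -tE /t.
    by rewrite conjugate_exponent_infty.
  have WE : normLp Om q%:E W = \int[mu]_(x in Om) (W x)%:E.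
    rewrite -[LHS]poweRe1 ?normLp_ge0// -[in X in _ `^ X]q1E poweR_normLp ?gt_eqF//.
    by apply: eq_integral => x _; rewrite q1E powRr1// ger0_norm.
  have mWE : measurable_fun Om (fun x => (W x)%:E) by exact/measurable_EFinP.
  have WE0 x : Om x -> 0 <= (W x)%:E by rewrite lee_fin.
  have tp0 : 0 <= (fine t `^ p)%:E by rewrite lee_fin powR_ge0.
  rewrite WE tE poweR_EFin -(ge0_integralZr mu mOm mWE WE0 tp0).
  apply: ae_ge0_le_integral => //.
  - by move=> x _; rewrite lee_fin mulr_ge0 ?powR_ge0.
  - by apply/measurable_EFinP/measurable_funM.
  - by move=> x _; rewrite -EFinM lee_fin mulr_ge0 ?powR_ge0.
  - by under eq_fun do rewrite -EFinM; apply/measurable_EFinP/measurable_funM.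
  move: ut; apply: filterS => x ux Omx.
  by rewrite -EFinM lee_fin ler_wpM2l// ler_powR2 ?(ltW p0)// ux.
have q10 : (0 < q - 1)%R by rewrite subr_gt0.
pose q' := (q / (q - 1))%R; have q'0 : (0 < q')%R by rewrite divr_gt0.
have qq' : (q^-1 + q'^-1 = 1)%R by rewrite /q' invf_div; field; rewrite gt_eqF.
pose v x := (`|u x| `^ p)%R.
have H := hoelder mu (measurable_patch mW) (measurable_patch mup) q0 q'0 qq'.
have -> : \int[mu]_(x in Om) (W x * `|u x| `^ p)%:E =
    'N[mu]_1[EFin \o ((W \_ Om) \* (v \_ Om))%R].
  rewrite Lnorm1 [LHS]integral_mkcond; apply: eq_integral => x _.
  rewrite /= /patch; case: ifPn => _; last by rewrite mul0r normr0.
  by rewrite [in RHS]ger0_norm// mulr_ge0 ?powR_ge0.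
apply: (le_trans H); rewrite lee_wpmul2l ?Lnorm_ge0//.
rewrite le_eqVlt; apply/orP; left; apply/eqP.
have NE : 'N[mu]_q'%:E[EFin \o (v \_ Om)]%R `^ q' = t `^ (p * q').
  have -> := @poweR_normLp R N Om q' v (lt0r_neq0 q'0).
  rewrite /t conjugate_exponent_finite//.
  have pq'0 : (p * q' != 0)%R by rewrite mulf_neq0 ?lt0r_neq0.
  rewrite -/q' (@poweR_normLp R N Om _ u pq'0); apply: eq_integral => x _.
  by rewrite /v ger0_norm ?powR_ge0// powRrM.
have := congr1 (fun z => z `^ q'^-1) NE.
rewrite -!poweRrM -mulrA divff ?gt_eqF// mulr1 poweRe1//.
exact: Lnorm_ge0.
Qed.

Lemma normLpZ (r : \bar R) u (c : R) : 1 <= r -> (0 < c)%R -> in_Lp Om r u ->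
  normLp Om r (fun x => c * u x)%R = c%:E * normLp Om r u.
Proof.
move=> r1 c0 Lu; have := LnormZ (p1 := r1) (Lfun_Sub r1 Lu) c.
rewrite gtr0_norm// => H.
rewrite /normLp -[in RHS](Lfun_valP r1 Lu) -H; congr Lnorm.
apply/funext => x; rewrite /= /patch.
by case: ifP => // _; rewrite scaler0.
Qed.

End embedding.

(** * Finiteness of the L^{p q'} norm by duality *)

Section conjugate_embedding.
Context {R : realType} {N : nat}.
Variable Om : set 'rV[R]_N.
Hypotheses (oOm : open Om) (bOm : bounded_set Om) (N0 : (0 < N)%N).
Let mu := lebesgue_rV (R := R) N.
Variables (p q : R).
Hypotheses (p1 : 1 < p) (pq : admissible_exponent N p q).
Local Open Scope ereal_scope.

Let mOm : measurable Om. Proof. exact: open_measurable_rV. Qed.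
Let p0 : (0 < p)%R. Proof. exact: lt_trans ltr01 p1. Qed.
Let q1 : (1 <= q)%R. Proof. exact: admissible_exponent_ge1 p1 pq. Qed.
Let q0 : (0 < q)%R. Proof. exact: lt_le_trans ltr01 q1. Qed.

(** The trace inequality for a single [u], its energy included in the constant: a bound on the p-th
    power of [|u|] as a functional on L^q. *)
Let trace (u : 'rV[R]_N -> R) := exists2 C : R, (0 <= C)%R &
  forall (W : 'rV[R]_N -> R) (K : R),
    measurable_fun setT W -> (forall x, (0 <= W x)%R) ->
    (forall x, W x != 0%R -> Om x) -> (0 < K)%R ->
    \int[mu]_x (W x `^ q)%:E <= (K `^ q)%:E ->
    \int[mu]_(x in Om) (W x * `|u x| `^ p)%:E <= (C * K)%:E.

(* The trace inequality is tested with the indicator of a superlevel set. *)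
Let normLp_infty_lty u : q = 1%R -> measurable_fun Om u -> trace u ->
  normLp Om +oo u < +oo.
Proof.
move=> q1E mu_ [C C0 tr]; pose L := ((C + 1) `^ p^-1 : R)%R.
have L0 : (0 <= L)%R by exact: powR_ge0.
have Lp : (L `^ p = C + 1)%R by rewrite powRVK ?gt_eqF// addr_ge0.
apply: (@le_lt_trans _ _ L%:E); last by rewrite ltry.
apply: normLp_infty_le => //.
pose A := Om `&` (fun x => `|u x|%R) @^-1` `]L, +oo[%classic.
have mA : measurable A by apply: (measurableT_comp _ mu_).
have AOm : A `<=` Om by move=> x [].
exists A; split => //; last first.
  move=> x /= /not_implyP[Omx /negP]; rewrite -ltNge => Lu; split => //=.
  by rewrite in_itv/= Lu.
have [//|A0] := eqVneq (mu A) 0; exfalso.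
have Ay : mu A < +oo.
  have : mu A <= mu Om by apply: le_measure; rewrite ?inE.
  by move=> /le_lt_trans; apply; exact: lebesgue_rV_bounded_lty.
have AE : mu A = (fine (mu A))%:E by rewrite fineK// ge0_fin_numE.
have A1 : (0 < fine (mu A))%R.
  by rewrite fine_gt0// Ay andbT lt0e A0 measure_ge0.
pose W : 'rV[R]_N -> R := \1_A.
have W1 x : A x -> W x = 1%R by move=> Ax; rewrite /W indicE mem_set.
have W0 x : (0 <= W x)%R by rewrite /W indicE.
have WOm x : W x != 0%R -> Om x.
  rewrite /W indicE; case: (boolP (x \in A)) => [/set_mem/AOm//|_].
  by rewrite eqxx.
have WK : \int[mu]_x (W x `^ q)%:E <= (fine (mu A) `^ q)%:E.
  rewrite q1E powRr1 ?(ltW A1)// -AE.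
  under eq_integral do rewrite powRr1//.
  by rewrite integral_indic// setIT.
have := tr W _ (measurable_indic mA) W0 WOm A1 WK; apply/negP; rewrite -ltNge.
apply: (@lt_le_trans _ _ ((C + 1)%:E * mu A)).
  by rewrite AE -EFinM lte_fin ltr_pM2r// ltrDl.
rewrite -integral_cst//.
apply: (@le_trans _ _ (\int[mu]_(x in A) (W x * `|u x| `^ p)%:E)).
  apply: ge0_le_integral => //.
  - by move=> x _; rewrite /= lee_fin addr_ge0.
  - apply/measurable_EFinP/measurable_funM; first exact: measurable_indic.
    by apply: measurable_powR_norm; apply: measurable_funS mu_.
  - move=> x Ax; rewrite W1// mul1r lee_fin -Lp ler_powR2 ?(ltW p0)//.
    by case: Ax => _; rewrite /= in_itv/= andbT => /ltW.
apply: ge0_subset_integral => //.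
- apply/measurable_EFinP/measurable_funM; first exact: measurable_indic.
  exact: measurable_powR_norm.
- by move=> x _; rewrite lee_fin mulr_ge0 ?powR_ge0.
Qed.

(** Let A be the integral of W |u|^p. It bounds the integral of W^q, so A^(1/q) may serve as [K],
    and A <= C A^(1/q), that is A^(1/q') <= C. Dividing requires A finite: [W] is bounded and [Om]
    has finite measure, so the trace inequality with some finite [K] applies beforehand. *)
Let trace_self_improve (u W : 'rV[R]_N -> R) (C B : R) : (1 < q)%R ->
  (0 <= C)%R -> (0 <= B)%R ->
  measurable_fun Om u -> measurable_fun setT W -> (forall x, (0 <= W x)%R) ->
  (forall x, (W x <= B)%R) -> (forall x, W x != 0%R -> Om x) ->
  (forall x, (W x `^ q <= W x * `|u x| `^ p)%R) ->
  (forall K : R, (0 < K)%R -> \int[mu]_x (W x `^ q)%:E <= (K `^ q)%:E ->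
    \int[mu]_(x in Om) (W x * `|u x| `^ p)%:E <= (C * K)%:E) ->
  \int[mu]_(x in Om) (W x * `|u x| `^ p)%:E <= (C `^ (q / (q - 1)))%:E.
Proof.
move=> q_gt1 C0 B0 mu_ mW W0 WB WOm WqWu tr.
have q10 : (0 < q - 1)%R by rewrite subr_gt0.
set q' := (q / (q - 1))%R; have q'0 : (0 < q')%R by rewrite divr_gt0.
have mWq : measurable_fun setT (fun x => (W x `^ q)%:E).
  by apply/measurable_EFinP; exact: (measurableT_comp (measurable_powR q)).
have WqE : \int[mu]_x (W x `^ q)%:E = \int[mu]_(x in Om) (W x `^ q)%:E.
  rewrite [RHS]integral_mkcond; apply: eq_integral => x _.
  rewrite /patch; case: ifPn => // /negP; rewrite inE => Omx.
  have [->|/WOm//] := eqVneq (W x) 0%R; by rewrite powR0// gt_eqF.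
have mWu : measurable_fun Om (fun x => (W x * `|u x| `^ p)%:E).
  apply/measurable_EFinP/measurable_funM; first exact: measurable_funTS.
  exact: measurable_powR_norm.
set A := \int[mu]_(x in Om) _ in tr *.
have A0 : 0 <= A.
  by apply: integral_ge0 => x _; rewrite lee_fin mulr_ge0 ?powR_ge0.
set I := \int[mu]_x _ in tr WqE.
have I0 : 0 <= I by apply: integral_ge0 => x _; rewrite lee_fin powR_ge0.
have IA : I <= A.
  rewrite WqE; apply: ge0_le_integral.
  - exact: mOm.
  - by move=> x _; rewrite lee_fin powR_ge0.
  - exact: measurable_funTS.
  - exact: mWu.
  - by move=> x _; rewrite lee_fin.
have Iy : I < +oo.
  apply: (@le_lt_trans _ _ ((B `^ q)%:E * mu Om)); last first.
    by rewrite lte_mul_pinfty ?lee_fin ?powR_ge0// lebesgue_rV_bounded_lty.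
  rewrite WqE -(integral_cst mu mOm); apply: ge0_le_integral.
  - exact: mOm.
  - by move=> x _; rewrite lee_fin powR_ge0.
  - exact: measurable_funTS.
  - exact: measurable_cst.
  - by move=> x _; rewrite lee_fin ler_powR2 ?(ltW q0).
have [i iE] : exists i : R, I = i%:E by exists (fine I); rewrite fineK// ge0_fin_numE.
have i0 : (0 <= i)%R by rewrite -lee_fin -iE.
have i1 : (0 < i + 1)%R by rewrite ltr_wpDl.
have Ay : A < +oo.
  apply: (@le_lt_trans _ _ (C * (i + 1) `^ q^-1)%:E); last exact: ltry.
  apply: tr; first by rewrite powR_gt0.
  by rewrite powRVK ?gt_eqF ?(ltW i1)// iE lee_fin lerDl.
have [a aE] : exists a : R, A = a%:E by exists (fine A); rewrite fineK// ge0_fin_numE.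
have a0 : (0 <= a)%R by rewrite -lee_fin -aE.
have [a_eq0|a_neq0] := eqVneq a 0%R.
  by rewrite aE a_eq0 lee_fin powR_ge0.
have a_gt0 : (0 < a)%R by rewrite lt_neqAle eq_sym a_neq0.
have aq0 : (0 < a `^ q^-1)%R by rewrite powR_gt0.
have := tr _ aq0; rewrite powRVK ?gt_eqF// -aE => /(_ IA).
rewrite aE !lee_fin => aC.
have qq' : (q^-1 + q'^-1 = 1)%R by rewrite /q' invf_div; field; rewrite gt_eqF.
have : (a `^ q'^-1 <= C)%R.
  rewrite -(ler_pM2r aq0) -powRD ?a_neq0 ?implybT//.
  by rewrite addrC qq' powRr1.
move=> /(ler_powR2 (ltW q'0) (powR_ge0 _ _)).
by rewrite powRVK ?gt_eqF.
Qed.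

(* The trace inequality is tested with a truncation [W] of [|u|^(p/(q-1))],
   for which [W^q <= W |u|^p]. *)
Let normLp_conjugate_lty u : (1 < q)%R -> measurable_fun Om u -> trace u ->
  normLp Om (p * (q / (q - 1)))%:E u < +oo.
Proof.
move=> q_gt1 mu_ [C C0 tr]; have q10 : (0 < q - 1)%R by rewrite subr_gt0.
pose q' := (q / (q - 1))%R; have q'0 : (0 < q')%R by rewrite divr_gt0.
pose s := ((q - 1)^-1)%R; have s0 : (0 < s)%R by rewrite invr_gt0.
have sq' : (q' - 1 = s)%R by rewrite /s /q'; field; rewrite gt_eqF.
pose v x := (`|u x| `^ p)%R.
have v0 x : (0 <= v x)%R by exact: powR_ge0.
have mv : measurable_fun Om v by exact: measurable_powR_norm.
have mvs : measurable_fun Om (fun x => v x `^ s)%R.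
  exact: (measurableT_comp (measurable_powR s)).
have key : \int[mu]_(x in Om) (v x `^ s * v x)%:E <= (C `^ q')%:E.
  apply: integral_min_le => //; first by move=> x _; exact: powR_ge0.
  move=> m; pose B : R := m.+1%:R; have B0 : (0 <= B)%R by rewrite ler0n.
  pose W := (fun x => Num.min (v x `^ s) B)%R \_ Om.
  have mW : measurable_fun setT W.
    by apply/(measurable_restrictT _ mOm); apply: measurable_minr.
  have W0 x : (0 <= W x)%R.
    by rewrite /W /patch; case: ifP => _ //; rewrite le_min powR_ge0 B0.
  have WB x : (W x <= B)%R.
    by rewrite /W /patch; case: ifP => _ //; rewrite ge_min lexx orbT.
  have WOm x : W x != 0%R -> Om x.
    by rewrite /W /patch; case: ifPn => [/set_mem//|_]; rewrite eqxx.
  have Wv x : (W x <= v x `^ s)%R.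
    by rewrite /W /patch; case: ifP => _; rewrite ?powR_ge0// ge_min lexx.
  have WE : \int[mu]_(x in Om) (Num.min (v x `^ s)%R B * v x)%:E =
      \int[mu]_(x in Om) (W x * v x)%:E.
    by apply: eq_integral => x Omx; rewrite /W /patch Omx.
  rewrite WE; clear WE; clearbody W.
  apply: (trace_self_improve q_gt1 C0 B0 mu_ mW W0 WB WOm).
    (* Write W^q as W times W^(q-1); the second factor is at most (v^s)^(q-1) = v. *)
    move=> x; rewrite -mulr_powRB1// ler_wpM2l//.
    apply: (@le_trans _ _ ((v x `^ s) `^ (q - 1))%R).
      by rewrite ler_powR2 ?(ltW q10).
    by rewrite powRVK ?gt_eqF.
  by move=> K K0; exact: tr.
have pq'0 : (p * q' != 0)%R by rewrite mulf_neq0 ?lt0r_neq0.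
apply: (lty_poweRy pq'0); rewrite -/q' (@poweR_normLp R N Om _ u pq'0).
apply: le_lt_trans (ltry (C `^ q')%R); apply: le_trans key.
rewrite le_eqVlt; apply/orP; left; apply/eqP; apply: eq_integral => x _.
by rewrite powRrM -/(v x) -(mulr_powRB1 (v0 x) q'0) sq' [in RHS]mulrC.
Qed.

Lemma W1p0_normLp_lty u Du : W1p0 Om p u Du ->
  normLp Om (p%:E * hoelder_conjugate q%:E) u < +oo.
Proof.
move=> uDu; have [mu_ _] := W1p_measurable oOm p1 uDu.1.
have [C C0 tr] := trace_inequality oOm bOm N0 p1 pq.
have Ey := dirichlet_energy_lty oOm p1 uDu.1.
have E0 := dirichlet_energy_ge0 Om p Du.
have EE : dirichlet_energy Om p Du = (fine (dirichlet_energy Om p Du))%:E.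
  by rewrite fineK// ge0_fin_numE.
have tru : trace u.
  exists (C * fine (dirichlet_energy Om p Du))%R.
    by rewrite mulr_ge0 ?(ltW C0)// fine_ge0.
  move=> W K mW W0 WOm K0 WK.
  by rewrite mulrAC EFinM -EE; exact: tr.
have [q_gt1|q_le1] := ltP 1%R q; last first.
  have q1E : q = 1%R by apply/eqP; rewrite eq_le q1 q_le1.
  by rewrite (conjugate_exponent_infty p1)//; exact: normLp_infty_lty.
by rewrite (conjugate_exponent_finite p1 pq)//; exact: normLp_conjugate_lty.
Qed.

End conjugate_embedding.

(** * Scaling and the Sobolev quotient *)

Section scaling.
Context {R : realType} {N : nat}.
Variable Om : set 'rV[R]_N.
Hypotheses (oOm : open Om).
Let mu := lebesgue_rV (R := R) N.
Variables (p : R).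
Hypotheses (p1 : 1 < p).
Implicit Types (u : 'rV[R]_N -> R) (Du : 'rV[R]_N -> 'rV[R]_N).

Let mOm : measurable Om. Proof. exact: open_measurable_rV. Qed.
Let p0 : (0 < p)%R. Proof. exact: lt_trans ltr01 p1. Qed.

(** Holds for integrals that do not converge as well: a positive factor leaves an infinite positive
    or negative part infinite, and [fine] sends the resulting infinite value to 0 on both sides. *)
Lemma Rintegral_pZl (c : R) (f : 'rV[R]_N -> R) : 0 < c -> measurable_fun Om f ->
  \int[mu]_(x in Om) (c * f x) = c * \int[mu]_(x in Om) f x.
Proof.
move=> c0 mf; have mfE : measurable_fun Om (EFin \o f) by exact/measurable_EFinP.
have key (a b : \bar R) : (0 <= a)%E -> (0 <= b)%E ->
    fine (c%:E * a - c%:E * b)%E = c * fine (a - b)%E.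
  case: a => [a| |] //; case: b => [b| |] // _ _;
    rewrite ?gt0_muley ?lte_fin//= ?mulr0//.
  by rewrite mulrBr.
rewrite /Rintegral; under eq_integral do rewrite EFinM.
rewrite integralE [in RHS]integralE ge0_funeposM ?(ltW c0)// ge0_funenegM ?(ltW c0)//.
rewrite !ge0_integralZl_EFin ?(ltW c0)//.
- by apply: key; apply: integral_ge0.
- exact: measurable_funeneg.
- exact: measurable_funepos.
Qed.

Lemma smoothZ (c : R) (f : 'rV[R]_N -> R) : smooth f -> smooth (fun x => c * f x).
Proof.
move=> sf s.
have E : foldr (@partial R N) (fun x => c * f x) s =
    (fun x => c * foldr (@partial R N) f s x).
  elim: s => [//|i s IH] /=; rewrite IH; apply/funext => x.
  by rewrite /partial; apply: (deriveZ c); have [_] := sf s; apply.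
rewrite E; have [cf df] := sf s; split.
  by move=> x; apply: continuousM; [exact: cst_continuous|exact: cf].
by move=> i x; have := @derivableZ R _ R^o _ c x _ (df i x).
Qed.

Lemma test_functionZ (c : R) phi : c != 0 -> test_function Om phi ->
  test_function Om (fun x => c * phi x).
Proof.
move=> c0 [sm co su]; rewrite /test_function /=.
rewrite (_ : [set x | c * phi x != 0] = [set x | phi x != 0]).
  by split => //; exact: smoothZ.
by apply/seteqP; split => x /=; rewrite mulf_eq0 (negbTE c0).
Qed.

Lemma normLp_pZ (r c : R) u : 0 < r -> 0 <= c -> measurable_fun Om u ->
  normLp Om r%:E (fun x => c * u x) = (c%:E * normLp Om r%:E u)%E.
Proof.
move=> r0 c0 mu_.
have r_neq0 : r != 0 by rewrite gt_eqF.
have H : (normLp Om r%:E (fun x => c * u x)%R `^ r = (c%:E * normLp Om r%:E u) `^ r)%E.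
  rewrite poweRM ?lee_fin ?normLp_ge0// !poweR_normLp//.
  rewrite -ge0_integralZl_EFin ?powR_ge0//.
  - apply: eq_integral => x _; rewrite -EFinM; congr (_%:E).
    by rewrite normrM powRM// ger0_norm.
  - by apply/measurable_EFinP; exact: measurable_powR_norm.
have := congr1 (fun z => z `^ r^-1)%E H.
rewrite -!poweRrM divff// !poweRe1 ?normLp_ge0//.
by rewrite mule_ge0 ?lee_fin ?normLp_ge0.
Qed.

Lemma in_LpZ (r c : R) u : 0 < r -> in_Lp Om r%:E u ->
  in_Lp Om r%:E (fun x => c * u x).
Proof.
move=> r0 /(in_LpP mOm _ r0)[mu_ uy]; apply/(in_LpP mOm _ r0); split.
  exact: measurable_funM.
have -> : (\int[mu]_(x in Om) (`|c * u x| `^ r)%:E =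
    (`|c| `^ r)%:E * \int[mu]_(x in Om) (`|u x| `^ r)%:E)%E.
  rewrite -ge0_integralZl_EFin ?powR_ge0//.
  - by apply: eq_integral => x _; rewrite -EFinM normrM powRM.
  - by apply/measurable_EFinP; exact: measurable_powR_norm.
by rewrite lte_mul_pinfty ?lee_fin ?powR_ge0.
Qed.

Lemma W1p0Z (c : R) u Du : 0 < c -> W1p0 Om p u Du ->
  W1p0 Om p (fun x => c * u x) (fun x => c *: Du x).
Proof.
move=> c0 [W [phi [tphi phiu dphi]]]; have [mu_ mDu] := W1p_measurable oOm p1 W.
case: W => Lu LDu wg.
have DuE i : (fun x => (c *: Du x) ord0 i) = (fun x => c * Du x ord0 i).
  by apply/funext => x; rewrite mxE.
split; first split.
- exact: in_LpZ.
- by move=> i; rewrite DuE; exact: in_LpZ.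
- move=> psi i tpsi.
  have [cpsi cdpsi _] := test_function_C1 tpsi.
  rewrite (eq_Rintegral _ (g := fun x => c * (u x * partial i psi x))); last first.
    by move=> x _; rewrite mulrA.
  rewrite [in RHS](eq_Rintegral _ (g := fun x => c * (Du x ord0 i * psi x))); last first.
    by move=> x _; rewrite mxE mulrA.
  rewrite !Rintegral_pZl// ?wg ?mulrN//.
  - apply: measurable_funM => //; apply: measurable_funTS.
    exact: continuous_measurable_rV.
  - apply: measurable_funM => //; apply: measurable_funTS.
    exact: continuous_measurable_rV.
exists (fun k x => c * phi k x).
have mphi k : measurable_fun Om (phi k).
  have [cphi _ _] := test_function_C1 (tphi k).
  by apply: measurable_funTS; exact: continuous_measurable_rV.
split=> [k||i].
- by apply: test_functionZ; rewrite ?gt_eqF.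
- under eq_cvg => k.
    rewrite (_ : _ \- _ = fun x => c * (phi k x - u x)); last first.
      by apply/funext => x /=; rewrite mulrBr.
    rewrite normLp_pZ//; [|exact: ltW|exact: measurable_funB].
    over.
  by have := cvgeZl (isT : c%:E \is a fin_num) phiu; rewrite mule0.
- under eq_cvg => k.
    rewrite (_ : _ \- _ = fun x => c * (partial i (phi k) x - Du x ord0 i)); last first.
      apply/funext => x /=; rewrite mulrBr mxE; congr (_ - _).
      rewrite /partial; apply: (deriveZ c).
      by have [_ _] := test_function_C1 (tphi k); apply.
    rewrite normLp_pZ//; [|exact: ltW|]; last first.
      apply: measurable_funB => //; apply: measurable_funTS.
      by have [_ ? _] := test_function_C1 (tphi k); exact: continuous_measurable_rV.
    over.
  by have := cvgeZl (isT : c%:E \is a fin_num) (dphi i); rewrite mule0.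
Qed.

Lemma enormZ (c : R) (v : 'rV[R]_N) : 0 <= c -> enorm (c *: v) = c * enorm v.
Proof.
move=> c0; rewrite /enorm (_ : dotv _ _ = c ^+ 2 * dotv v v); last first.
  by rewrite /dotv mulr_sumr; apply: eq_bigr => i _; rewrite !mxE; ring.
by rewrite sqrtrM ?sqr_ge0// sqrtr_sqr ger0_norm.
Qed.

Lemma dirichlet_energyZ (c : R) u Du : 0 <= c -> W1p Om p u Du ->
  dirichlet_energy Om p (fun x => c *: Du x) =
  ((c `^ p)%:E * dirichlet_energy Om p Du)%E.
Proof.
move=> c0 /(W1p_measurable oOm p1)[_ mDu].
rewrite /dirichlet_energy -ge0_integralZl_EFin ?powR_ge0//.
- by apply: eq_integral => x _; rewrite -EFinM enormZ// powRM ?enorm_ge0.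
- by move=> x _; rewrite lee_fin powR_ge0.
- by apply/measurable_EFinP; exact: measurable_powR_enorm.
Qed.

(** If the norm is nonzero, [u] divided by it competes in the infimum. A real [k] stands for the
    Sobolev constant, which may be [+oo]. *)
Lemma sobolev_constant_le (r : \bar R) (k : R) u Du : (1 <= r)%E ->
  (k%:E <= sobolev_constant Om p r)%E -> W1p0 Om p u Du -> in_Lp Om r u ->
  (k%:E * normLp Om r u `^ p <= dirichlet_energy Om p Du)%E.
Proof.
move=> r1 kS uDu Lu; set t := normLp Om r u.
have t0 : (0 <= t)%E by exact: normLp_ge0.
have ty : (t < +oo)%E by case/andP: Lu => _; rewrite inE.
have tE : t = (fine t)%:E by rewrite fineK// ge0_fin_numE.
have [t_eq0|t_neq0] := eqVneq (fine t) 0.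
  rewrite tE t_eq0 poweR_EFin powR0 ?gt_eqF// mule0.
  exact: dirichlet_energy_ge0.
have t_gt0 : 0 < fine t by rewrite lt_neqAle eq_sym t_neq0 fine_ge0.
have ti0 : 0 < (fine t)^-1 by rewrite invr_gt0.
have : (sobolev_constant Om p r <=
    dirichlet_energy Om p (fun x => (fine t)^-1 *: Du x))%E.
  apply: ereal_inf_lbound; exists (fun x => (fine t)^-1 * u x).
  exists (fun x => (fine t)^-1 *: Du x); split => //; first exact: W1p0Z.
  by rewrite normLpZ// -/t tE -EFinM mulVf.
rewrite (dirichlet_energyZ (ltW ti0) uDu.1) => /(le_trans kS).
rewrite tE poweR_EFin powRV ?(ltW t_gt0)// => H.
have tp0 : (0 < (fine t) `^ p) by rewrite powR_gt0.
have := lee_wpmul2r (ltW tp0 : (0 <= (fine t `^ p)%:E)%E) H.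
by rewrite muleAC -(EFinM _^-1) mulVf ?gt_eqF// mul1e.
Qed.

End scaling.

(** * Energies, coercivity and continuity *)

Section energies.
Context {R : realType} {N : nat}.
Variable Om : set 'rV[R]_N.
Hypotheses (oOm : open Om) (bOm : bounded_set Om) (N0 : (0 < N)%N).
Let mu := lebesgue_rV (R := R) N.
Variables (p q : R).
Hypotheses (p1 : 1 < p) (pq : admissible_exponent N p q).
Implicit Types (u g V W : 'rV[R]_N -> R) (Du : 'rV[R]_N -> 'rV[R]_N).

Let mOm : measurable Om. Proof. exact: open_measurable_rV. Qed.
Let p0 : 0 < p. Proof. exact: lt_trans ltr01 p1. Qed.
Let q1 : 1 <= q. Proof. exact: admissible_exponent_ge1 p1 pq. Qed.
Let q0 : 0 < q. Proof. exact: lt_le_trans ltr01 q1. Qed.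

Definition grad_energy Du : R := \int[mu]_(x in Om) enorm (Du x) `^ p.
Definition weight_energy W u : R := \int[mu]_(x in Om) (W x * `|u x| `^ p).

Lemma grad_energy_ge0 Du : 0 <= grad_energy Du.
Proof. by apply: Rintegral_ge0 => x _; exact: powR_ge0. Qed.

Lemma dirichlet_energyE u Du : W1p0 Om p u Du ->
  dirichlet_energy Om p Du = (grad_energy Du)%:E.
Proof.
move=> uDu; rewrite /grad_energy /Rintegral fineK//.
by rewrite ge0_fin_numE ?dirichlet_energy_ge0// (dirichlet_energy_lty oOm p1 uDu.1).
Qed.

Lemma integrable_grad_energy u Du : W1p0 Om p u Du ->
  mu.-integrable Om (fun x => (enorm (Du x) `^ p)%:E).
Proof.
move=> uDu; have [_ mDu] := W1p_measurable oOm p1 uDu.1.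
apply/integrableP; split.
  by apply/measurable_EFinP; exact: measurable_powR_enorm.
rewrite (eq_integral (fun x => (enorm (Du x) `^ p)%:E)).
  exact: (dirichlet_energy_lty oOm p1 uDu.1).
by move=> x _; rewrite gee0_abs// lee_fin powR_ge0.
Qed.

Lemma measurable_weight W u Du : W1p0 Om p u Du -> measurable_fun Om W ->
  measurable_fun Om (fun x => W x * `|u x| `^ p).
Proof.
move=> uDu mW; have [mu_ _] := W1p_measurable oOm p1 uDu.1.
by apply: measurable_funM => //; exact: measurable_powR_norm.
Qed.

(** The trace inequality for signed weights, applied to [|W|] extended by zero. It makes all
    energies finite and Lipschitz in the weight. *)
Lemma weight_energy_bound : exists2 C : R, 0 < C &
  forall u Du W (K : R), W1p0 Om p u Du -> measurable_fun Om W ->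
    0 < K -> (normLp Om q%:E W <= K%:E)%E ->
    mu.-integrable Om (fun x => (W x * `|u x| `^ p)%:E) /\
    `|weight_energy W u| <= C * K * grad_energy Du.
Proof.
have [C C0 tr] := trace_inequality oOm bOm N0 p1 pq.
exists C => // u Du W K uDu mW K0 WK.
have mWu := measurable_weight uDu mW.
have bound : (\int[mu]_(x in Om) `|(W x * `|u x| `^ p)%:E| <=
    (C * K * grad_energy Du)%:E)%E.
  pose W' := (fun x => `|W x|) \_ Om.
  rewrite EFinM -(dirichlet_energyE uDu).
  apply: le_trans (tr u Du W' K uDu _ _ _ K0 _).
  - rewrite le_eqVlt; apply/orP; left; apply/eqP; apply: eq_integral => x Omx.
    by rewrite /W' /patch Omx /= normrM (ger0_norm (powR_ge0 _ _)).
  - apply/(measurable_restrictT _ mOm); exact: measurableT_comp.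
  - by move=> x; rewrite /W' /patch; case: ifP.
  - by move=> x; rewrite /W' /patch; case: ifPn => [/set_mem//|_]; rewrite eqxx.
  - rewrite (_ : \int[mu]_x _ = normLp Om q%:E W `^ q)%E; last first.
      rewrite poweR_normLp ?gt_eqF// [RHS]integral_mkcond.
      apply: eq_integral => x _.
      by rewrite /W' /patch; case: ifP => // _; rewrite powR0// gt_eqF.
    rewrite -poweR_EFin; apply: gt0_ler_poweR; rewrite ?(ltW q0)//.
      by rewrite in_itv/= leey normLp_ge0.
    by rewrite in_itv/= leey lee_fin ltW.
have iWu : mu.-integrable Om (fun x => (W x * `|u x| `^ p)%:E).
  apply/integrableP; split; first exact/measurable_EFinP.
  by apply: le_lt_trans bound _; rewrite ltry.
split => //; rewrite -lee_fin; apply: le_trans bound.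
rewrite /weight_energy /Rintegral -abse_EFin fineK; last exact: integrable_fin_num.
by apply: le_abse_integral => //; exact/measurable_EFinP.
Qed.

Lemma in_Lp_measurable W : in_Lp Om q%:E W -> measurable_fun Om W.
Proof. by move=> /(in_LpP mOm _ q0)[]. Qed.

Lemma in_Lp_normLp_le W : in_Lp Om q%:E W ->
  exists2 K : R, 0 < K & (normLp Om q%:E W <= K%:E)%E.
Proof.
rewrite /in_Lp inE => /andP[_]; rewrite inE/= /finite_norm -/(normLp Om q%:E W) => Wy.
have W0 := normLp_ge0 Om q%:E W.
exists (fine (normLp Om q%:E W) + 1); first by rewrite ltr_wpDl// fine_ge0.
by rewrite -[leLHS]fineK ?ge0_fin_numE// lee_fin lerDl.
Qed.

Lemma integrable_weight_energy W u Du : in_Lp Om q%:E W -> W1p0 Om p u Du ->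
  mu.-integrable Om (fun x => (W x * `|u x| `^ p)%:E).
Proof.
move=> LW uDu; have [K K0 WK] := in_Lp_normLp_le LW.
have [C _ H] := weight_energy_bound.
by have [] := H u Du W K uDu (in_Lp_measurable LW) K0 WK.
Qed.

Lemma energyE V u Du : in_Lp Om q%:E V -> W1p0 Om p u Du ->
  \int[mu]_(x in Om) (enorm (Du x) `^ p + V x * `|u x| `^ p) =
  grad_energy Du + weight_energy V u.
Proof.
move=> LV uDu; rewrite RintegralD//; first exact: integrable_grad_energy uDu.
exact: integrable_weight_energy LV uDu.
Qed.

Lemma weight_energyB W1 W2 u Du :
  in_Lp Om q%:E W1 -> in_Lp Om q%:E W2 -> W1p0 Om p u Du ->
  weight_energy (W1 \- W2) u = weight_energy W1 u - weight_energy W2 u.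
Proof.
move=> L1 L2 uDu; rewrite /weight_energy -RintegralB//.
- by apply: eq_Rintegral => x _; rewrite /= mulrBl.
- exact: integrable_weight_energy L1 uDu.
- exact: integrable_weight_energy L2 uDu.
Qed.

(** Dividing [u] by the p-th root of its weighted integral [a] restores the constraint. In this form
    the minimality can be tested with minimizers of neighbouring problems. *)
Lemma constrained_energies_homogeneous g V u Du (l : R) :
  in_Lp Om q%:E g -> in_Lp Om q%:E V -> W1p0 Om p u Du ->
  lbound (constrained_energies Om p g V) l -> 0 < weight_energy g u ->
  l * weight_energy g u <= grad_energy Du + weight_energy V u.
Proof.
move=> Lg LV uDu lbl; set a := weight_energy g u => a0.
have [mu_ mDu] := W1p_measurable oOm p1 uDu.1.
pose c := a `^ (- p^-1); have c0 : 0 < c by rewrite powR_gt0.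
have cp : c `^ p = a^-1.
  by rewrite /c -powRrM mulNr mulVf ?gt_eqF// powR_inv1 ?ltW.
have cuDu := W1p0Z oOm p1 c0 uDu.
have cu x : `|c * u x| `^ p = a^-1 * `|u x| `^ p.
  by rewrite normrM powRM// (gtr0_norm c0) cp.
have wE W : measurable_fun Om W -> weight_energy W (fun x => c * u x) =
    a^-1 * weight_energy W u.
  move=> mW; rewrite /weight_energy -Rintegral_pZl ?invr_gt0//.
  - by apply: eq_Rintegral => x _; rewrite cu mulrCA.
  - exact: measurable_weight uDu mW.
have gE : grad_energy (fun x => c *: Du x) = a^-1 * grad_energy Du.
  rewrite /grad_energy -Rintegral_pZl ?invr_gt0//.
  - by apply: eq_Rintegral => x _; rewrite enormZ ?(ltW c0)// powRM ?(ltW c0) ?enorm_ge0// cp.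
  - exact: measurable_powR_enorm.
have : l <= grad_energy (fun x => c *: Du x) + weight_energy V (fun x => c * u x).
  apply: lbl; exists (fun x => c * u x), (fun x => c *: Du x); split => //.
  - rewrite -/(weight_energy g _) wE; last exact: in_Lp_measurable.
    by rewrite mulVf ?gt_eqF.
  - by rewrite energyE.
rewrite gE wE; last exact: in_Lp_measurable.
by rewrite -mulrDr ler_pdivlMl// mulrC.
Qed.

End energies.

(** * Coercivity for admissible potentials *)

Section coercivity.
Context {R : realType} {N : nat}.
Variable Om : set 'rV[R]_N.
Hypotheses (oOm : open Om) (bOm : bounded_set Om) (N0 : (0 < N)%N).
Let mu := lebesgue_rV (R := R) N.
Variables (p q : R).
Hypotheses (p1 : 1 < p) (pq : admissible_exponent N p q).
Implicit Types (u g V W : 'rV[R]_N -> R) (Du : 'rV[R]_N -> 'rV[R]_N).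

Let mOm : measurable Om. Proof. exact: open_measurable_rV. Qed.
Let p0 : 0 < p. Proof. exact: lt_trans ltr01 p1. Qed.
Let grad := grad_energy Om p.
Let weight := weight_energy Om p.

Lemma sobolev_constant_ge0 r : (0 <= sobolev_constant Om p r)%E.
Proof.
apply: le_ereal_inf_tmp => _ [u [Du [_ _ ->]]].
exact: dirichlet_energy_ge0.
Qed.

Lemma W1p0_in_Lp_conjugate u Du : W1p0 Om p u Du ->
  in_Lp Om (p%:E * hoelder_conjugate q%:E)%E u.
Proof.
move=> uDu; have [mu_ _] := W1p_measurable oOm p1 uDu.1.
rewrite /in_Lp inE; apply/andP; rewrite !inE/=; split.
  exact/(measurable_restrictT _ mOm).
exact: (W1p0_normLp_lty oOm bOm N0 p1 pq uDu).
Qed.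

(** By Hölder's inequality and the definition of S_{p q'}, the negative part of [V] lowers the
    energy by at most [fine n / k] times the gradient energy, a fraction less than 1. *)
Lemma coercive_negative_part V : in_Lp Om q%:E V ->
  (normLp Om q%:E (fun x => Num.min (V x) 0%R) <
     sobolev_constant Om p (p%:E * hoelder_conjugate q%:E))%E ->
  exists2 c : R, 0 < c & forall u Du, W1p0 Om p u Du ->
    c * grad Du <= grad Du + weight V u.
Proof.
move=> LV; set S := sobolev_constant _ _ _; set n := normLp _ _ _ => nS.
have mV := in_Lp_measurable oOm p1 pq LV.
have n0 : (0 <= n)%E by exact: normLp_ge0.
have nE : n = (fine n)%:E.
  by rewrite fineK// ge0_fin_numE// (lt_le_trans nS)// leey.
have fn0 : 0 <= fine n by exact: fine_ge0.
have [k nk kS] : exists2 k : R, fine n < k & (k%:E <= S)%E.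
  have [Sy|Sy] := eqVneq S +oo%E.
    by exists (fine n + 1); rewrite ?ltrDl// Sy leey.
  have SE : S = (fine S)%:E.
    by rewrite fineK// ge0_fin_numE ?sobolev_constant_ge0// ltey.
  by exists (fine S); rewrite -?SE// -lte_fin -nE -SE.
have k0 : 0 < k := le_lt_trans fn0 nk.
exists (1 - fine n / k); first by rewrite subr_gt0 ltr_pdivrMr// mul1r.
move=> u Du uDu; have [mu_ _] := W1p_measurable oOm p1 uDu.1.
pose W x := `|Num.min (V x) 0|.
have mW : measurable_fun Om W.
  by apply: measurableT_comp => //; apply: measurable_minr.
have Lu := W1p0_in_Lp_conjugate uDu.
have ty := W1p0_normLp_lty oOm bOm N0 p1 pq uDu.
set t := normLp Om _ u in ty.
have t0 : (0 <= t)%E by exact: normLp_ge0.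
have tE : t = (fine t)%:E by rewrite fineK// ge0_fin_numE.
have kt : k * fine t `^ p <= grad Du.
  rewrite -lee_fin /grad -(dirichlet_energyE oOm p1 uDu) EFinM -poweR_EFin -tE.
  apply: (sobolev_constant_le oOm p1 _ kS uDu Lu).
  exact: conjugate_exponent_ge1 p1 pq.
have WE : normLp Om q%:E W = n.
  rewrite /n /normLp -[in RHS]Lnorm_abse; congr Lnorm; apply/funext => x /=.
  by rewrite /W /patch; case: ifP => // _; rewrite normr0.
have W0 x : 0 <= W x by exact: normr_ge0.
have := hoelder_trace oOm p1 pq mu_ mW W0 ty.
rewrite WE -/t nE tE poweR_EFin -EFinM => WnE.
have LW : in_Lp Om q%:E W.
  rewrite /in_Lp inE; apply/andP; rewrite !inE/=; split.
    exact/(measurable_restrictT _ mOm).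
  by rewrite /finite_norm -/(normLp Om q%:E W) WE nE ltry.
have iW := integrable_weight_energy oOm bOm N0 p1 pq LW uDu.
have iV := integrable_weight_energy oOm bOm N0 p1 pq LV uDu.
have Wn : weight W u <= fine n * fine t `^ p.
  by rewrite -lee_fin /weight /weight_energy /Rintegral fineK//; exact: integrable_fin_num.
have VW : - weight W u <= weight V u.
  rewrite -subr_ge0 opprK addrC /weight /weight_energy -RintegralD//.
  apply: Rintegral_ge0 => x _; rewrite -mulrDl mulr_ge0 ?powR_ge0// /W.
  have [V0|V0] := leP (V x) 0; first by rewrite ler0_norm// addNr.
  by rewrite normr0 add0r ltW.
have ntk : fine n * fine t `^ p <= fine n / k * grad Du.
  by rewrite -mulrA ler_wpM2l// ler_pdivlMl.
by move: (le_trans Wn ntk) VW; rewrite mulrBl mul1r; lra.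
Qed.

Lemma weight_energy_eq0 W u Du : in_Lp Om q%:E W -> W1p0 Om p u Du ->
  normLp Om p%:E u = 0%E -> weight W u = 0.
Proof.
move=> LW uDu u0; have [mu_ _] := W1p_measurable oOm p1 uDu.1.
have p0E : (0 < p%:E)%E by rewrite lte_fin.
have muOm : measurable_fun setT (EFin \o (u \_ Om)).
  by apply/measurable_EFinP; exact/(measurable_restrictT _ mOm).
have := Lnorm_eq0_eq0 muOm p0E u0.
move=> uae; rewrite /weight /weight_energy /Rintegral.
rewrite (ae_eq_integral (cst 0%E))//.
- by rewrite integral0.
- by apply/measurable_EFinP; exact: (measurable_weight oOm p1 uDu (in_Lp_measurable oOm p1 pq LW)).
- move: uae; apply: filterS => x /= uae Omx.
  have := uae I; rewrite /patch mem_set// => -[->].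
  by rewrite normr0 powR0 ?gt_eqF// mulr0.
Qed.

(** The Poincaré inequality with constant S_p compensates all of the negative part of [V] except a
    surplus of [delta], which is traded for a fraction of the gradient energy. *)
Lemma coercive_lower_bound V (delta : R) : in_Lp Om q%:E V -> 0 < delta ->
  (\forall x \ae mu, Om x ->
     (- sobolev_constant Om p p%:E + delta%:E <= (V x)%:E)%E) ->
  exists2 c : R, 0 < c & forall u Du, W1p0 Om p u Du ->
    c * grad Du <= grad Du + weight V u.
Proof.
move=> LV delta0; set S := sobolev_constant _ _ _ => VS.
have mV := in_Lp_measurable oOm p1 pq LV.
have p1E : (1 <= p%:E)%E by rewrite lee_fin ltW.
have normE u Du : W1p0 Om p u Du ->
    exists2 m : R, 0 <= m & normLp Om p%:E u = m%:E.
  move=> [[Lu _ _] _]; have t0 := normLp_ge0 Om p%:E u.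
  exists (fine (normLp Om p%:E u)); first exact: fine_ge0.
  by rewrite fineK// ge0_fin_numE//; case/andP: Lu => _; rewrite inE.
(* If the constant is infinite, every function has L^p norm 0: otherwise its energy would exceed any
   multiple of the p-th power of that norm. *)
have [Sy|Sy] := eqVneq S +oo%E.
  exists 1 => // u Du uDu; rewrite mul1r lerDl.
  have [m m0 mE] := normE u Du uDu.
  suff m_eq0 : m = 0 by rewrite (weight_energy_eq0 LV uDu)// mE m_eq0.
  apply/eqP; apply: contrapT => /negP m_neq0.
  have mp : 0 < m `^ p by rewrite powR_gt0// lt_neqAle eq_sym m_neq0.
  pose k := (grad Du + 1) / m `^ p.
  have kS : (k%:E <= sobolev_constant Om p p%:E)%E by rewrite -/S Sy leey.
  have Lu : in_Lp Om p%:E u by case: uDu.1.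
  have := sobolev_constant_le oOm p1 p1E kS uDu Lu.
  rewrite (dirichlet_energyE oOm p1 uDu) mE poweR_EFin -EFinM lee_fin.
  by rewrite divfK ?gt_eqF// leNgt ltrDl ltr01.
have S0 : (0 <= S)%E by exact: sobolev_constant_ge0.
have SE : S = (fine S)%:E by rewrite fineK// ge0_fin_numE// ltey.
have s0 : 0 <= fine S by exact: fine_ge0.
set s := fine S in SE s0.
have sd0 : 0 < s + delta by rewrite ltr_wpDl.
exists (delta / (s + delta)); first by rewrite divr_gt0.
move=> u Du uDu; have [mu_ _] := W1p_measurable oOm p1 uDu.1.
have [m m0 mE] := normE u Du uDu.
have sm : s * m `^ p <= grad Du.
  rewrite -lee_fin /grad -(dirichlet_energyE oOm p1 uDu) EFinM -poweR_EFin -mE.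
  have Lu : in_Lp Om p%:E u by case: uDu.1.
  by apply: (sobolev_constant_le oOm p1 p1E _ uDu Lu); rewrite -/S SE.
have mpE : (\int[mu]_(x in Om) (`|u x| `^ p)%:E = (m `^ p)%:E)%E.
  by rewrite -poweR_normLp ?gt_eqF// mE poweR_EFin.
(* Equal to [V] almost everywhere, but bounded below at every point, as the monotonicity of the
   integral requires. *)
pose V' x := Num.max (V x) (delta - s).
have mV' : measurable_fun Om V' by apply: measurable_maxr.
have VV' : weight V u = weight V' u.
  rewrite /weight /weight_energy /Rintegral; congr fine; apply: ae_eq_integral => //.
  - by apply/measurable_EFinP; exact: (measurable_weight oOm p1 uDu).
  - by apply/measurable_EFinP; exact: (measurable_weight oOm p1 uDu).
  - move: VS; apply: filterS => x /= VS Omx; have := VS Omx.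
    rewrite SE -EFinN -EFinD lee_fin addrC => H.
    by rewrite /V' (max_idPl H).
have iV := integrable_weight_energy oOm bOm N0 p1 pq LV uDu.
have iup : mu.-integrable Om (fun x => (`|u x| `^ p)%:E).
  apply/integrableP; split.
    by apply/measurable_EFinP; exact: measurable_powR_norm.
  rewrite (eq_integral (fun x => (`|u x| `^ p)%:E)) ?mpE ?ltry//.
  by move=> x _; rewrite gee0_abs// lee_fin powR_ge0.
have iZ : mu.-integrable Om (fun x => ((delta - s) * `|u x| `^ p)%:E).
  exact: (integrableZl mOm (delta - s) iup).
have iV' : mu.-integrable Om (fun x => (V' x * `|u x| `^ p)%:E).
  apply: (@le_integrable _ _ _ mu Om mOm _
    (fun x => (`|V x * `|u x| `^ p| + `|(delta - s) * `|u x| `^ p|)%:E)).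
  - by apply/measurable_EFinP; exact: (measurable_weight oOm p1 uDu).
  - move=> x _; rewrite lee_fin [leRHS]ger0_norm ?addr_ge0//.
    rewrite /V'; case: (leP (V x) (delta - s)) => _.
      by rewrite lerDr.
    by rewrite lerDl.
  - under eq_fun do rewrite EFinD; apply: integrableD => //.
      exact: (integrable_norm iV).
    exact: (integrable_norm iZ).
have lowV : (delta - s) * m `^ p <= weight V u.
  rewrite VV'.
  have -> : m `^ p = \int[mu]_(x in Om) (`|u x| `^ p) by rewrite /Rintegral mpE.
  rewrite -RintegralZl//; apply: le_Rintegral => //.
  by move=> x _; rewrite ler_wpM2r ?powR_ge0// le_max lexx orbT.
(* With [c * (s + delta) = delta], the difference of the two sides becomes [(1 - c) * (G' - s * M')
   + (delta - c * s) * M'], where [delta - c * s = c * delta]; both terms are nonnegative. *)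
set c := delta / (s + delta).
have cs : c * (s + delta) = delta by rewrite divfK ?gt_eqF.
have c1 : c <= 1 by rewrite ler_pdivrMr// mul1r lerDr.
have c0 : 0 < c by rewrite divr_gt0.
have mp0 : 0 <= m `^ p by exact: powR_ge0.
apply: (@le_trans _ _ (grad Du + (delta - s) * m `^ p)); last by rewrite lerD2l.
have aux (G' M' : R) : 0 <= M' -> s * M' <= G' ->
    c * G' <= G' + (delta - s) * M'.
  move=> M'0 sG; rewrite -subr_ge0.
  have -> : G' + (delta - s) * M' - c * G' =
      (1 - c) * (G' - s * M') + (delta - c * s) * M' by ring.
  rewrite addr_ge0 ?mulr_ge0 ?subr_ge0// -[leRHS]cs mulrDr lerDl.
  by rewrite mulr_ge0// ltW.
exact: aux.
Qed.

Lemma admissible_coercive g V : admissible Om p q g V ->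
  exists2 c : R, 0 < c & forall u Du, W1p0 Om p u Du ->
    c * grad Du <= grad Du + weight V u.
Proof.
move=> [_ LV [VS|[delta delta0 VS]] _]; first exact: coercive_negative_part.
exact: coercive_lower_bound VS.
Qed.

End coercivity.

(** * Upper and lower estimates for neighbouring eigenvalues *)

Section perturbation.
Context {R : realType} {N : nat}.
Variable Om : set 'rV[R]_N.
Hypotheses (oOm : open Om) (bOm : bounded_set Om) (N0 : (0 < N)%N).
Variables (p q : R).
Hypotheses (p1 : 1 < p) (pq : admissible_exponent N p q).
Implicit Types (g V W : 'rV[R]_N -> R).

Let weight_energy_close (C K : R) W1 W2 u Du :
  (forall u Du W (K : R), W1p0 Om p u Du -> measurable_fun Om W ->
    0 < K -> (normLp Om q%:E W <= K%:E)%E ->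
    `|weight_energy Om p W u| <= C * K * grad_energy Om p Du) ->
  in_Lp Om q%:E W1 -> in_Lp Om q%:E W2 -> 0 < K ->
  (normLp Om q%:E (W1 \- W2)%R <= K%:E)%E -> W1p0 Om p u Du ->
  `|weight_energy Om p W1 u - weight_energy Om p W2 u| <=
  C * K * grad_energy Om p Du.
Proof.
move=> bound L1 L2 K0 W12 uDu.
rewrite -(weight_energyB oOm bOm N0 p1 pq L1 L2 uDu); apply: bound => //.
apply: measurable_funB; exact: (in_Lp_measurable oOm p1 pq).
Qed.

(** The minimizer for [(g, V)] has weighted integral at least [1 - eta] and energy at most
    [lam + eta] in the perturbed problem, so [lam' * (1 - eta) <= lam + eta]. *)
Lemma lambda_upper g V (lam : R) : in_Lp Om q%:E g -> in_Lp Om q%:E V ->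
  is_lambda Om p g V lam -> forall eps : R, 0 < eps ->
  exists2 K : R, 0 < K & forall g' V' (lam' : R),
    in_Lp Om q%:E g' -> in_Lp Om q%:E V' ->
    (normLp Om q%:E (g' \- g)%R <= K%:E)%E ->
    (normLp Om q%:E (V' \- V)%R <= K%:E)%E ->
    is_lambda Om p g' V' lam' -> lam' <= lam + eps.
Proof.
move=> Lg LV [[lam0 _] [u [Du [uDu gu lamE]]] _] eps eps0.
have [C C0 bound] := weight_energy_bound oOm bOm N0 p1 pq.
rewrite (energyE oOm bOm N0 p1 pq LV uDu) in lamE.
rewrite -/(weight_energy Om p g u) in gu.
have G0 := grad_energy_ge0 Om p Du.
set G := grad_energy Om p Du in lamE G0.
have CG0 : 0 < C * (G + 1) by rewrite mulr_gt0// ltr_wpDl.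
have l0 : 0 < 1 + lam + eps by rewrite !addr_gt0.
(* The solution of [lam + eta = (lam + eps) * (1 - eta)]. *)
pose eta := eps / (1 + lam + eps).
have eta0 : 0 < eta by rewrite divr_gt0.
have etaE : eta * (1 + lam + eps) = eps by rewrite divfK ?gt_eqF.
have eta1 : eta < 1.
  by rewrite ltr_pdivrMr// mul1r ltrDr addr_gt0.
exists (eta / (C * (G + 1))); first by rewrite divr_gt0.
set K := eta / _; have K0 : 0 < K by rewrite divr_gt0.
have KG : C * K * G <= eta.
  have -> : eta = C * (G + 1) * K by rewrite mulrC divfK ?gt_eqF.
  by rewrite mulrAC ler_pM2r// ler_pM2l// lerDl.
move=> g' V' lam' Lg' LV' gK VK [[lam'0 _] _ lb'].
have bound' := fun u Du W K uDu mW K0 WK => (bound u Du W K uDu mW K0 WK).2.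
have := le_trans (weight_energy_close bound' Lg' Lg K0 gK uDu) KG.
have := le_trans (weight_energy_close bound' LV' LV K0 VK uDu) KG.
rewrite gu ler_norml => /andP[_ Vu]; rewrite ler_norml => /andP[g'u _].
have g'u1 : 1 - eta <= weight_energy Om p g' u by lra.
have g'u0 : 0 < weight_energy Om p g' u by lra.
have H := constrained_energies_homogeneous oOm bOm N0 p1 pq Lg' LV' uDu lb' g'u0.
have H1 : lam' * (1 - eta) <= lam + eta.
  apply: (@le_trans _ _ (lam' * weight_energy Om p g' u)).
    by rewrite ler_wpM2l// ltW.
  by apply: (le_trans H); rewrite -/G; lra.
have eta1' : 0 < 1 - eta by rewrite subr_gt0.
rewrite -(ler_pM2r eta1') (le_trans H1)//.
rewrite -subr_ge0 (_ : _ - _ = eps - eta * (1 + lam + eps)); last by ring.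
by rewrite etaE subrr.
Qed.

(** The roles are exchanged, but the minimizer now varies with [(g', V')]. The assumed bound
    [lam' <= lam + 1] and the coercivity for [V] bound its gradient energy by a constant [B] that is
    fixed before [K]. *)
Lemma lambda_lower g V (lam : R) : admissible Om p q g V ->
  is_lambda Om p g V lam -> forall eps : R, 0 < eps ->
  exists2 K : R, 0 < K & forall g' V' (lam' : R),
    in_Lp Om q%:E g' -> in_Lp Om q%:E V' ->
    (normLp Om q%:E (g' \- g)%R <= K%:E)%E ->
    (normLp Om q%:E (V' \- V)%R <= K%:E)%E ->
    is_lambda Om p g' V' lam' -> lam' <= lam + 1 -> lam - eps <= lam'.
Proof.
move=> adm [[lam0 _] _ lb] eps eps0; have [Lg LV _ _] := adm.
have [C C0 bound] := weight_energy_bound oOm bOm N0 p1 pq.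
have bound' := fun u Du W K uDu mW K0 WK => (bound u Du W K uDu mW K0 WK).2.
have [c c0 coer] := admissible_coercive oOm bOm N0 p1 pq adm.
(* From [c * G <= lam' + C * K * G <= (lam + 1) + c / 2 * G]. *)
pose B := 2 * (lam + 1) / c.
have lam1 : 0 < lam + 1 by rewrite addr_gt0.
have B0 : 0 < B by rewrite divr_gt0// mulr_gt0.
(* The bound [1 / 2] keeps the weighted integral positive; the other one turns
   [lam * (1 - eta) <= lam' + eta] into the claim. *)
pose eta := Num.min (eps / (lam + 1)) (1 / 2).
have eta0 : 0 < eta by rewrite lt_min !divr_gt0.
have eta1 : eta <= 1 / 2 by rewrite ge_min lexx orbT.
have etaE : eta * (lam + 1) <= eps by rewrite -ler_pdivlMr// ge_min lexx.
(* The second bound makes the perturbation of [V] absorbable by coercivity and thus yields [G <= B];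
   the first then makes both perturbations at most [eta]. *)
pose K := Num.min (eta / (C * B)) (c / (2 * C)).
have K0 : 0 < K by rewrite lt_min !divr_gt0// mulr_gt0.
have KB : C * K * B <= eta.
  have CB0 : 0 < C * B by rewrite mulr_gt0.
  by rewrite mulrAC mulrC -(ler_pdivlMr _ _ CB0) /K ge_min lexx.
have Kc : C * K <= c / 2.
  have : K <= c / (2 * C) by rewrite /K ge_min lexx orbT.
  rewrite invfM mulrA => H; rewrite mulrC -ler_pdivlMr//.
exists K => // g' V' lam' Lg' LV' gK VK [_ [u [Du [uDu gu lamE]]] _] lam'1.
rewrite (energyE oOm bOm N0 p1 pq LV' uDu) in lamE.
rewrite -/(weight_energy Om p g' u) in gu.
have G0 := grad_energy_ge0 Om p Du.
have := coer u Du uDu.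
have := weight_energy_close bound' Lg' Lg K0 gK uDu.
have := weight_energy_close bound' LV' LV K0 VK uDu.
set G := grad_energy Om p Du in G0 lamE *.
rewrite gu !ler_norml => /andP[V1 V2] /andP[g1 g2] cG.
have CKG : C * K * G <= c / 2 * G by rewrite ler_wpM2r.
have GB : G <= B.
  by rewrite /B ler_pdivlMr//; lra.
have CKB : C * K * G <= eta.
  by apply: le_trans KB; rewrite ler_wpM2l// mulr_ge0// ltW.
have gu0 : 0 < weight_energy Om p g u by lra.
have H := constrained_energies_homogeneous oOm bOm N0 p1 pq Lg LV uDu lb gu0.
have H1 : lam * (1 - eta) <= lam' + eta.
  apply: (@le_trans _ _ (lam * weight_energy Om p g u)).
    by rewrite ler_wpM2l//; [exact: ltW|lra].
  by apply: (le_trans H); rewrite -/G; lra.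
lra.
Qed.

End perturbation.

Theorem proposition4p1 (R : realType) (N : nat) (Om : set 'rV[R]_N) (p q : R)
    (g V : 'rV[R]_N -> R) (gn Vn : nat -> 'rV[R]_N -> R)
    (lam : R) (lamn : nat -> R) :
  (2 <= N)%N -> bounded_smooth_domain Om -> 1 < p ->
  admissible_exponent N p q ->
  (forall n, admissible Om p q (gn n) (Vn n)) -> admissible Om p q g V ->
  normLp Om q%:E (gn n \- g) @[n --> \oo] --> 0%E ->
  normLp Om q%:E (Vn n \- V) @[n --> \oo] --> 0%E ->
  (forall n, is_lambda Om p (gn n) (Vn n) (lamn n)) ->
  is_lambda Om p g V lam ->
  lamn n @[n --> \oo] --> lam.
Proof.
move=> N2 [_ oOm _ bOm _] p1 pq admn adm gng VnV lamnE lamE.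
have N0 : (0 < N)%N by exact: ltnW.
have [Lg LV _ _] := adm.
have near_le (W : 'rV[R]_N -> R) (Wn : nat -> 'rV[R]_N -> R) (K : R) : 0 < K ->
    normLp Om q%:E (Wn n \- W) @[n --> \oo] --> 0%E ->
    \forall n \near \oo, (normLp Om q%:E (Wn n \- W)%R <= K%:E)%E.
  move=> K0 WnW; have K0E : (0 < K%:E)%E by rewrite lte_fin.
  have : \forall n \near \oo, (normLp Om q%:E (Wn n \- W)%R < K%:E)%E.
    exact: (WnW _ (open_ereal_lt' K0E)).
  by apply: filterS => n /ltW.
apply/cvgrPdist_le => eps eps0.
(* The upper estimate with [eps] equal to 1 supplies the a priori bound [lamn n <= lam + 1] that the
   lower estimate assumes. *)
have [K1 K10 up1] := lambda_upper oOm bOm N0 p1 pq Lg LV lamE ltr01.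
have [K2 K20 up2] := lambda_upper oOm bOm N0 p1 pq Lg LV lamE eps0.
have [K3 K30 low] := lambda_lower oOm bOm N0 p1 pq adm lamE eps0.
near=> n; have [Lgn LVn _ _] := admn n.
have lamn1 : lamn n <= lam + 1.
  by apply: (up1 (gn n) (Vn n)) => //; near: n; exact: near_le.
have lamn2 : lamn n <= lam + eps.
  by apply: (up2 (gn n) (Vn n)) => //; near: n; exact: near_le.
have lamn3 : lam - eps <= lamn n.
  by apply: (low (gn n) (Vn n)) => //; near: n; exact: near_le.
by rewrite ler_distl lerBlDr lamn2 -lerBlDr lamn3.
Unshelve. all: by end_near. Qed.
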